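(* Let $p$ be an odd prime, let $n\ge 4$ be an even integer, and let $f:\mathbb{F}_p^n\to\mathbb{F}_p$ be a non-weakly regular bent function belonging to $\mathcal{DBF}$ such that $B_-(f)$ and $B_-(f^* )$ are both non-degenerate $r$-dimensional subspaces over $\mathbb{F}_p$. (i) If $r=\frac n2+1$, then $$U_6=\Big\{\{0\},\ c_0(f),\ \bigcup_{i\in SQ}c_i(f),\ \bigcup_{i\in NSQ}c_i(f),\ d_0(f)\setminus\{0\},\ \bigcup_{i\in SQ}d_i(f),\ \bigcup_{i\in NSQ}d_i(f)\Big\}$$ is a partition of $\mathbb{F}_p^n$ and induces a $6$-class symmetric association scheme, and $$U_7=\Big\{\{0\},\ c_0(f),\ \bigcup_{i\in\mathbb{F}_p^*}c_i(f),\ d_0(f)\setminus\{0\},\ \bigcup_{i\in\mathbb{F}_p^*}d_i(f)\Big\}$$ is a partition of $\mathbb{F}_p^n$ and induces a $4$-class symmetric association scheme. (ii) If $\frac n2+1<r\le n-1$, then $$U_8=\Big\{\{0\},\ c_0(f),\ \bigcup_{i\in SQ}c_i(f),\ \bigcup_{i\in NSQ}c_i(f),\ B_-(f)^\bot\setminus\{0\},\ d_0(f)\setminus B_-(f)^\bot,\ \bigcup_{i\in SQ}d_i(f),\ \bigcup_{i\in NSQ}d_i(f)\Big\}$$ is a partition of $\mathbb{F}_p^n$ and induces a $7$-class symmetric association scheme, and $$U_9=\Big\{\{0\},\ c_0(f),\ \bigcup_{i\in\mathbb{F}_p^*}c_i(f),\ B_-(f)^\bot\setminus\{0\},\ d_0(f)\setminus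 B_-(f)^\bot,\ \bigcup_{i\in\mathbb{F}_p^*}d_i(f)\Big\}$$ is a partition of $\mathbb{F}_p^n$ and induces a $5$-class symmetric association scheme.
   Context: Let $p$ be an odd prime, $n$ a positive integer, $x\cdot y$ the ordinary inner product on $\mathbb{F}_p^n$, and $\xi_p=e^{2\pi\sqrt{-1}/p}$. $SQ$ and $NSQ$ denote the sets of squares and of nonsquares in $\mathbb{F}_p^*$. Bent functions. For $f:\mathbb{F}_p^n\to\mathbb{F}_p$ the Walsh transform is $\mathcal{W}_f(\alpha)=\sum_{x\in\mathbb{F}_p^n}\xi_p^{f(x)-\alpha\cdot x}$, $\alpha\in\mathbb{F}_p^n$; $f$ is bent if $|\mathcal{W}_f(\alpha)|=p^{n/2}$ for all $\alpha$. Put $\mu=1$ if $p^n\equiv1\pmod 4$ and $\mu=\sqrt{-1}$ if $p^n\equiv3\pmod4$. For a bent $f$ it is known that for every $\alpha$, $\mathcal{W}_f(\alpha)\in\{\mu p^{n/2}\xi_p^{f^*(\alpha)},-\mu p^{n/2}\xi_p^{f^*(\alpha)}\}$ for a (unique) function $f^*:\mathbb{F}_p^n\to\mathbb{F}_p$, called the dual of $f$. A bent $f$ is weakly regular if there is $\lambda\in\{\pm1,\pm\sqrt{-1}\}$ independent of $\alpha$ with $\mathcal{W}_f(\alpha)=\lambda p^{n/2}\xi_p^{f^*(\alpha)}$ for all $\alpha$; otherwise it is non-weakly regular. A bent $f$ is dual-bent if $f^*$ is also bent. For a bent function $f$: $B_+(f)=\{\alpha:\mathcal{W}_f(\alpha)=\mu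 p^{n/2}\xi_p^{f^*(\alpha)}\}$ and $B_-(f)=\{\alpha:\mathcal{W}_f(\alpha)=-\mu p^{n/2}\xi_p^{f^*(\alpha)}\}$. For $f$ dual-bent, $B_\pm(f^* )$ are defined by the same formulas applied to the bent function $f^*$. For dual-bent $f$ and $j\in\mathbb{F}_p$: $c_j(f)=\{x\in B_+(f^* ):f(x)=j\}$, $d_j(f)=\{x\in B_-(f^* ):f(x)=j\}$. $\mathcal{DBF}$ is the set of dual-bent functions $f:\mathbb{F}_p^n\to\mathbb{F}_p$ such that $f(0)=0$ and there is a positive integer $h$ with $\gcd(h-1,p-1)=1$ and $f(ax)=a^hf(x)$ for all $a\in\mathbb{F}_p^*$, $x\in\mathbb{F}_p^n$. For a subspace $V$ of $\mathbb{F}_p^n$, $V^\bot$ is its orthogonal complement with respect to $\cdot$; $V$ is non-degenerate if $\{x\in V:x\cdot y=0\ \text{for all } y\in V\}=\{0\}$. Association schemes. A $d$-class association scheme on a nonempty finite set $X$ is a partition of $X\times X$ into relations $R_0,\dots,R_d$ such that $R_0=\{(x,x):x\in X\}$; for each $j$ the transpose $R_j^T$ equals some $R_{j'}$; and for all $u,v,w$ and $(x,y)\in R_w$ the number $|\{z\in X:(x,z)\in R_u,(z,y)\in R_v\}|$ depends only on $u,v,w$. It is symmetric if $R_j^T=R_j$ for all $j$. A partition $\{U_i\}_{i=0}^d$ of $\mathbb{F}_p^n$ (into nonempty sets) with $U_0=\{0\}$ induces a $d$-class symmetric association scheme if the relations $R_i=\{(\alpha,\beta):\alpha-\beta\in U_i\}$,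 $0\le i\le d$, form a symmetric association scheme on $\mathbb{F}_p^n$. *)

(* Defs.v *)
From HB Require Import structures.
From mathcomp Require Import all_boot all_order all_algebra.
From mathcomp Require Import complex.
From mathcomp Require Import reals trigo.

Set Implicit Arguments.
Unset Strict Implicit.
Unset Printing Implicit Defensive.

Import Order.TTheory GRing.Theory Num.Theory.
Local Open Scope ring_scope.
Local Open Scope complex_scope.

Section LinearAlgebra.
Variables p n : nat.
Local Notation V := 'rV['F_p]_n.

Definition dot (x y : V) : 'F_p := \sum_(i < n) x 0 i * y 0 i.

Definition perp (A : {set V}) : {set V} :=
  [set x | [forall y in A, dot x y == 0]].

Definition is_subspace_of_dim (A : {set V}) (r : nat) : Prop :=
  exists2 U : {vspace V}, A = [set x | x \in U] & \dim U = r.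

Definition nondegenerate_space (A : {set V}) : Prop :=
  [set x in A | [forall y in A, dot x y == 0]] = [set 0].

End LinearAlgebra.

Definition SQ (p : nat) : {set 'F_p} :=
  [set a | (a != 0) && [exists b, a == b ^+ 2]].

Definition NSQ (p : nat) : {set 'F_p} :=
  [set a | (a != 0) && ~~ [exists b, a == b ^+ 2]].

Section Bent.
Variables (R : realType) (p n : nat).
Local Notation V := 'rV['F_p]_n.

Definition iC : R[i] := 0 +i* 1.

(* e^(2 pi i / p) *)
Definition xi : R[i] := cos (2 * pi / p%:R) +i* sin (2 * pi / p%:R).

(* Exponents of xi are elements of 'F_p, read through their representatives in
   {0, ..., p - 1}. *)
Definition chi (a : 'F_p) : R[i] := xi ^+ val a.

Definition walsh (f : V -> 'F_p) (alpha : V) : R[i] :=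
  \sum_(x : V) chi (f x - dot alpha x).

(* p^(n/2), for n of either parity *)
Definition half_pow : R[i] := (Num.sqrt (p%:R ^+ n))%:C.

Definition mu : R[i] := if (p ^ n %% 4 == 1)%N then 1 else iC.

Definition bent (f : V -> 'F_p) : Prop :=
  forall alpha, `|walsh f alpha| = half_pow.

(* For p an odd prime and f bent, exactly one j satisfies the disjunction at
   each alpha; the default value 0 is only taken when there is none. *)
Definition dual (f : V -> 'F_p) (alpha : V) : 'F_p :=
  odflt 0 [pick j : 'F_p | (walsh f alpha == mu * half_pow * chi j)
                        || (walsh f alpha == - (mu * half_pow * chi j))].

Definition weakly_regular (f : V -> 'F_p) : Prop :=
  exists2 lambda : R[i], lambda \in [:: 1; -1; iC; - iC] &
    forall alpha, walsh f alpha = lambda * half_pow * chi (dual f alpha).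

Definition dual_bent (f : V -> 'F_p) : Prop := bent f /\ bent (dual f).

Definition Bplus (f : V -> 'F_p) : {set V} :=
  [set alpha | walsh f alpha == mu * half_pow * chi (dual f alpha)].

Definition Bminus (f : V -> 'F_p) : {set V} :=
  [set alpha | walsh f alpha == - (mu * half_pow * chi (dual f alpha))].

Definition cset (f : V -> 'F_p) (j : 'F_p) : {set V} :=
  [set x in Bplus (dual f) | f x == j].

Definition dset (f : V -> 'F_p) (j : 'F_p) : {set V} :=
  [set x in Bminus (dual f) | f x == j].

Definition DBF (f : V -> 'F_p) : Prop :=
  [/\ dual_bent f, f 0 = 0 &
      exists h : nat, [/\ (0 < h)%N, coprime (h - 1) (p - 1) &
        forall (a : 'F_p) (x : V), a != 0 -> f (a *: x) = a ^+ h * f x]].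

End Bent.

Section Schemes.

(* A tuple lists the parts of a partition: they are nonempty, pairwise
   distinct, pairwise disjoint, and cover T. *)
Definition tuple_partition (T : finType) (d : nat) (U : d.-tuple {set T}) :
    Prop :=
  uniq U /\ partition [set:: U] [set: T].

Definition rel_transpose (X : finType) (A : {set X * X}) : {set X * X} :=
  [set xy | (xy.2, xy.1) \in A].

Definition assoc_scheme (X : finType) (d : nat) (Rel : d.+1.-tuple {set X * X}) :
    Prop :=
  [/\ tuple_partition Rel,
      tnth Rel ord0 = [set xy | xy.1 == xy.2],
      forall j, exists j', rel_transpose (tnth Rel j) = tnth Rel j' &
      forall u v w, exists k : nat, forall x y, (x, y) \in tnth Rel w ->
        #|[set z | ((x, z) \in tnth Rel u) && ((z, y) \in tnth Rel v)]| = k].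

Definition symmetric_assoc_scheme (X : finType) (d : nat)
    (Rel : d.+1.-tuple {set X * X}) : Prop :=
  assoc_scheme Rel /\ forall j, rel_transpose (tnth Rel j) = tnth Rel j.

Definition diff_rel (p n : nat) (A : {set 'rV['F_p]_n}) :
    {set 'rV['F_p]_n * 'rV['F_p]_n} :=
  [set xy | xy.1 - xy.2 \in A].

Definition induces_symmetric_scheme (p n d : nat)
    (U : d.+1.-tuple {set 'rV['F_p]_n}) : Prop :=
  [/\ tuple_partition U, tnth U ord0 = [set 0] &
      symmetric_assoc_scheme (map_tuple (@diff_rel p n) U)].

End Schemes.

Arguments induces_symmetric_scheme {p n} d U.

Section Families.
Variables (R : realType) (p n : nat) (f : 'rV['F_p]_n -> 'F_p).
Local Notation V := 'rV['F_p]_n.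
Local Notation c := (cset R f).
Local Notation d := (dset R f).
Local Notation Bperp := (perp (Bminus R f)).

Definition U6 : 7.-tuple {set V} :=
  [tuple [set 0]; c 0;
         \bigcup_(i in SQ p) c i; \bigcup_(i in NSQ p) c i;
         d 0 :\ 0;
         \bigcup_(i in SQ p) d i; \bigcup_(i in NSQ p) d i].

Definition U7 : 5.-tuple {set V} :=
  [tuple [set 0]; c 0; \bigcup_(i : 'F_p | i != 0) c i;
         d 0 :\ 0; \bigcup_(i : 'F_p | i != 0) d i].

Definition U8 : 8.-tuple {set V} :=
  [tuple [set 0]; c 0;
         \bigcup_(i in SQ p) c i; \bigcup_(i in NSQ p) c i;
         Bperp :\ 0; d 0 :\: Bperp;
         \bigcup_(i in SQ p) d i; \bigcup_(i in NSQ p) d i].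

Definition U9 : 6.-tuple {set V} :=
  [tuple [set 0]; c 0; \bigcup_(i : 'F_p | i != 0) c i;
         Bperp :\ 0; d 0 :\: Bperp; \bigcup_(i : 'F_p | i != 0) d i].

End Families.

(* Main.v *)
(* Write g for the dual of f, P = p ^ (n / 2), U = Bminus f and W = Bminus g.
   Homogeneity and parity in Z[xi] give dual g = f and g 0 = 0, so f and g play
   symmetric roles.  Fourier inversion yields
     sum_(x in W) xi^(f x + a.x) = - P xi^(g a) if a is in U, and 0 otherwise;
   in particular the orthogonal of U lies in W and f vanishes on it.  Expanding in
   characters of F_p and applying the Galois automorphisms of Q(xi), one sees that
   the Fourier transform of a function constant on the parts built from
   (f, W, orthogonal of U) is constant on the parts built from
   (g, U, orthogonal of W).  By symmetry the functions constant on the parts are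
   closed under convolution, which is the scheme property.  That the parts are
   nonempty, and that d_0(f) is the orthogonal of U when r = n / 2 + 1, is read off
   from the same transforms at 0. *)
Require Import Defs.
From mathcomp Require Import all_boot all_order all_algebra all_field.
From mathcomp Require Import cyclic complex zify ring lra.
From mathcomp Require Import reals trigo.

Set Implicit Arguments.
Unset Strict Implicit.
Unset Printing Implicit Defensive.

Import Order.TTheory GRing.Theory Num.Theory.
Local Open Scope ring_scope.

(** The definition of [dual] only picks an exponent if one exists, so the classical fact that Walsh
    values of a bent function are [p^m xi^j] up to sign (with [m = n/2]) has to be proved. It
    concerns elements of [Z[xi]] of squared modulus [p^(2m)]: [1 - xi] is prime and associate to its
    conjugate, and its [(p-1)]-st power is [p] up to a unit, so [p^m] divides such an element; the
    quotient has modulus one, hence is a signed root of unity. No automorphism of [Q(xi)] is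
    constructed: integral relations among the powers of [xi] have constant coefficients, and such
    relations survive a permutation of the exponents. All four partitions are handled through one
    relation [similar], with [k = 2] or [k = 1]. The two ranges of [r] differ in whether the zeros
    of [f] in [W] exhaust the orthogonal of [U]: there are [p^(r-1) - p^m + p^(m-1)] zeros against
    [p^(n-r)] vectors, equal for [r = m + 1], with more zeros for larger [r]. *)

Lemma de_moivre (R : realType) (t : R) (k : nat) :
  (Complex (cos t) (sin t)) ^+ k = Complex (cos (t *+ k)) (sin (t *+ k)).
Proof.
elim: k => [|k IHk]; first by rewrite expr0 mulr0n cos0 sin0.
rewrite exprS IHk mulrS cosD sinD; apply/eqP; rewrite eq_complex /=.
by apply/andP; split; apply/eqP; ring.
Qed.

Lemma indexed_partition (T : finType) d (A : d.-tuple {set T}) :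
  (forall i, exists x, x \in tnth A i) -> (forall x, exists i, x \in tnth A i) ->
  (forall i j x, x \in tnth A i -> x \in tnth A j -> i = j) ->
  tuple_partition A.
Proof.
move=> A_neq0 A_cover A_triv; split.
  apply/tuple_uniqP => i j Aij; have [x xi] := A_neq0 i.
  by apply: (A_triv i j x); rewrite // -Aij.
apply/and3P; split.
- rewrite eqEsubset subsetT; apply/subsetP => x _.
  have [i xi] := A_cover x; apply/bigcupP; exists (tnth A i) => //.
  by rewrite inE mem_tnth.
- apply/trivIsetP => B B'; rewrite !inE => /tnthP[i ->] /tnthP[j ->] ij.
  rewrite -setI_eq0; apply/eqP/setP => x; rewrite !inE.
  by apply/negP => /andP[xi xj]; rewrite (A_triv _ _ _ xi xj) eqxx in ij.
rewrite inE; apply/negP => /tnthP[i iE]; have [x] := A_neq0 i.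
by rewrite -iE inE.
Qed.

(** * Additive characters *)

Section Characters.
Variables (R : realType) (p : nat).
Hypotheses (p_prime : prime p) (p_odd : odd p).
Local Notation F := 'F_p.
Local Notation C := R[i].
Local Notation chi := (@chi R p).

Let p_gt2 : (2 < p)%N.
Proof. exact: odd_prime_gt2. Qed.

(** The order divides the prime [p], so only [xi = 1] must be excluded: [cos (2t) = 1] at
    [t = pi / p] would force [sin t = 0], although [0 < t < pi]. *)
Lemma xi_prim_root : p.-primitive_root (xi R p).
Proof.
have p0 : (p%:R : R) != 0 by rewrite pnatr_eq0 -lt0n prime_gt0.
have xip : xi R p ^+ p = 1.
  have tE : 2 * pi / p%:R *+ p = pi *+ 2 :> R.
    by rewrite -[LHS]mulr_natr mulfVK // mulr_natl.
  by rewrite /xi de_moivre tE cos2pi sin2pi.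
have [m m_prim] := prim_order_exists (prime_gt0 p_prime) xip.
case/primeP: (p_prime) => _ p_div /p_div /orP[/eqP m1|/eqP mp]; last by rewrite -{1}mp.
move: m_prim; rewrite m1 => /prim_expr_order; rewrite expr1 => /eqP.
rewrite /xi eq_complex /= => /andP[/eqP c1 _].
have: 0 < sin (pi / p%:R : R).
  apply: sin_gt0_pi; rewrite divr_gt0 ?pi_gt0 ?ltr0n ?prime_gt0 //=.
  by rewrite ltr_pdivrMr ?ltr0n ?prime_gt0 // ltr_pMr ?pi_gt0 // ltr1n prime_gt1.
have := c1; rewrite -mulrA mulr_natl cos_mulr2n.
have := cos2Dsin2 (pi / p%:R : R).
set s := sin _; set c := cos _ => h1 h2 s0.
have : s ^+ 2 = 0 by lra.
by move/eqP; rewrite sqrf_eq0 (gt_eqF s0).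
Qed.

Lemma chi_nat k : chi k%:R = xi R p ^+ k.
Proof.
by rewrite /Defs.chi /= val_Fp_nat // (prim_expr_mod xi_prim_root).
Qed.

Lemma chi0 : chi 0 = 1.
Proof. by rewrite (chi_nat 0). Qed.

Lemma chiD a b : chi (a + b) = chi a * chi b.
Proof. by rewrite -[a]natr_Zp -[b]natr_Zp -natrD !chi_nat exprD. Qed.

Lemma chi_neq0 a : chi a != 0.
Proof.
apply/eqP => ha; have := chiD a (- a).
by rewrite subrr chi0 ha mul0r => /eqP; rewrite oner_eq0.
Qed.

Lemma chiN a : chi (- a) = (chi a)^-1.
Proof. by apply: (mulfI (chi_neq0 a)); rewrite -chiD subrr chi0 divff ?chi_neq0. Qed.

Lemma chi_conj a : (chi a)^* = chi (- a).
Proof.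
rewrite chiN /Defs.chi.
apply: (mulfI (chi_neq0 a)); rewrite divff ?chi_neq0 // -normCK /Defs.chi.
rewrite normrX; have -> : `|xi R p| = 1; last by rewrite !expr1n.
by rewrite /xi normc_def cos2Dsin2 sqrtr1.
Qed.

Lemma chi_eq1 a : (chi a == 1) = (a == 0).
Proof.
apply/eqP/eqP => [|->]; last exact: chi0.
move/eqP; rewrite /Defs.chi -(prim_order_dvd xi_prim_root) => /dvdnP[k ak].
by rewrite -[a]natr_Zp ak natrM (pcharf0 (pchar_Fp p_prime)) mulr0.
Qed.

Lemma sum_chi (t : F) : \sum_a chi (a * t) = if t == 0 then p%:R else 0.
Proof.
case: eqVneq => [->|t0].
  under eq_bigr do rewrite mulr0 chi0.
  by rewrite sumr_const card_Fp.
set S := \sum_a _; have : chi t * S = S.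
  rewrite /S mulr_sumr [RHS](reindex_inj (addrI 1)); apply: eq_bigr => a _.
  by rewrite mulrDl mul1r chiD.
move/eqP; rewrite -subr_eq0 -{2}[S]mul1r -mulrBl mulf_eq0 subr_eq0 chi_eq1.
by rewrite (negPf t0) => /eqP.
Qed.

(** * Orthogonality relations on F_p^n and its subspaces *)

Section Orthogonality.
Variable n : nat.
Local Notation V := 'rV[F]_n.

Lemma dotC (x y : V) : dot x y = dot y x.
Proof. by apply: eq_bigr => i _; rewrite mulrC. Qed.

Lemma dotDr (x y z : V) : dot x (y + z) = dot x y + dot x z.
Proof. by rewrite -big_split; apply: eq_bigr => i _; rewrite mxE mulrDr. Qed.

Lemma dotZr a (x y : V) : dot x (a *: y) = a * dot x y.
Proof. by rewrite mulr_sumr; apply: eq_bigr => i _; rewrite mxE mulrCA. Qed.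

Lemma dotZl a (x y : V) : dot (a *: x) y = a * dot x y.
Proof. by rewrite dotC dotZr dotC. Qed.

Lemma dotNr (x y : V) : dot x (- y) = - dot x y.
Proof. by rewrite -scaleN1r dotZr mulN1r. Qed.

Lemma dotNl (x y : V) : dot (- x) y = - dot x y.
Proof. by rewrite dotC dotNr dotC. Qed.

Lemma dot0r (x : V) : dot x 0 = 0.
Proof. by rewrite -(scale0r x) dotZr mul0r. Qed.

Lemma dot0l (x : V) : dot 0 x = 0.
Proof. by rewrite dotC dot0r. Qed.

Lemma sum_chi_subspace (U : {vspace V}) (a : V) :
  \sum_(x in U) chi (dot a x) =
    if a \in perp [set x | x \in U] then #|U|%:R else 0.
Proof.
rewrite inE; case: ifP => [/forall_inP h|/negbT].
  rewrite (eq_bigr (fun=> 1)) ?sumr_const // => x xU.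
  by have := h x; rewrite inE dotC => /(_ xU)/eqP; rewrite dotC => ->; rewrite chi0.
rewrite negb_forall => /existsP[y]; rewrite negb_imply inE => /andP[yU ay].
set S := \sum_(x in U) _; have : chi (dot a y) * S = S.
  rewrite /S mulr_sumr [RHS](reindex_inj (addrI y)) /=.
  apply: eq_big => [x|x _]; last by rewrite dotDr chiD.
  by rewrite rpredDl.
move/eqP; rewrite -subr_eq0 -{2}[S]mul1r -mulrBl mulf_eq0 subr_eq0 chi_eq1.
by rewrite (negPf ay) => /eqP.
Qed.

Lemma sum_chi_dot (a : V) :
  \sum_x chi (dot a x) = if a == 0 then (p ^ n)%:R else 0.
Proof.
have := sum_chi_subspace fullv a.
rewrite (eq_bigl xpredT) => [->|x]; last by rewrite memvf.
have -> : (a \in perp [set x : V | x \in fullv]) = (a == 0).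
  rewrite inE; apply/forall_inP/eqP => [h|-> y _]; last by rewrite dot0l.
  apply/rowP => i; have := h (delta_mx 0 i); rewrite inE memvf => /(_ isT)/eqP.
  rewrite /dot (bigD1 i) //= big1 => [|j ji]; rewrite !mxE ?eqxx ?(negPf ji) ?mulr0 //.
  by rewrite mulr1 addr0.
by rewrite card_vspace dimvf /dim /= card_Fp // mul1n.
Qed.

End Orthogonality.

(** * The cyclotomic polynomial of prime index *)

Lemma sum_Fp (T : nmodType) (G : nat -> T) : \sum_(i : F) G i = \sum_(i < p) G i.
Proof.
by rewrite -(big_mkord xpredT G) -[in RHS](big_mkord xpredT G) Fp_cast.
Qed.

Definition cyclo_poly (A : nzRingType) : {poly A} := \poly_(i < p) 1.

Lemma size_cyclo_poly (A : nzRingType) : size (cyclo_poly A) = p.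
Proof. by rewrite size_poly_eq ?oner_eq0. Qed.

Lemma map_cyclo_poly (A B : nzRingType) (g : {rmorphism A -> B}) :
  map_poly g (cyclo_poly A) = cyclo_poly B.
Proof.
apply/polyP => i; rewrite coef_map !coef_poly; case: ifP => _.
  exact: rmorph1.
exact: rmorph0.
Qed.

Lemma cyclo_poly_root (A : idomainType) (z : A) :
  p.-primitive_root z -> root (cyclo_poly A) z.
Proof.
move=> zp; rewrite /root /cyclo_poly horner_poly.
under eq_bigr do rewrite mul1r.
have /eqP : (z - 1) * \sum_(i < p) z ^+ i = 0.
  by rewrite -subrX1 (prim_expr_order zp) subrr.
rewrite mulf_eq0 subr_eq0 -{1}[z]expr1 -(prim_order_dvd zp) dvdn1.
by rewrite (gtn_eqF (prime_gt1 p_prime)).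
Qed.

(** Irreducibility over [rat] does not depend on the chosen root. It is read off in [algC], where
    the minimal polynomial of a primitive root has degree [totient p], and then serves for the root
    [xi] in [C]. *)
Lemma cyclo_poly_irreducible : irreducible_poly (cyclo_poly rat).
Proof.
have [z zp] := C_prim_root_exists (prime_gt0 p_prime).
have c0 : cyclo_poly rat != 0 by rewrite -size_poly_gt0 size_cyclo_poly prime_gt0.
apply/(@subfx_irreducibleP _ algC ratr z) => //.
  by rewrite map_cyclo_poly cyclo_poly_root.
move=> q qz q0; have [m [mE m_monic] mP] := minCpolyP z.
have := minCpoly_cyclotomic zp; rewrite mE => /(congr1 (fun q : {poly algC} => size q)).
rewrite size_map_poly size_cyclotomic totient_prime // prednK ?prime_gt0 // => szm.
by rewrite size_cyclo_poly -szm dvdp_leq // -mP.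
Qed.

Lemma size_root_xi (q : {poly rat}) :
  root (map_poly ratr q : {poly C}) (xi R p) -> q != 0 -> (p <= size q)%N.
Proof.
have c0 : cyclo_poly rat != 0 by rewrite -size_poly_gt0 size_cyclo_poly prime_gt0.
rewrite -{2}(size_cyclo_poly rat); move: q.
apply/(@subfx_irreducibleP _ C ratr (xi R p)) => //.
  by rewrite map_cyclo_poly cyclo_poly_root // xi_prim_root.
exact: cyclo_poly_irreducible.
Qed.
(** * Arithmetic of the ring of integers of Q(xi) *)

(** Elements of [Z[xi]] are handled as values of integer polynomials at [xi]; divisibility of [x] by
    [y] in this ring appears as [x = y * ev w]. *)
Definition ev : {rmorphism {poly int} -> C} :=
  horner_morph (fun a : int => mulrC (xi R p) (a%:~R)).

Lemma evE g : ev g = (map_poly intr g : {poly C}).[xi R p].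
Proof. by []. Qed.

Lemma ev_cyclo_poly : ev (cyclo_poly int) = 0.
Proof. by rewrite evE map_cyclo_poly; apply/rootP/cyclo_poly_root/xi_prim_root. Qed.

Lemma cyclo_poly_monic : cyclo_poly int \is monic.
Proof.
by rewrite monicE lead_coefE size_cyclo_poly coef_poly ltn_predL prime_gt0.
Qed.

Lemma ev_mod g : exists q r,
  [/\ g = q * cyclo_poly int + r, ev g = ev r & (size r < p)%N].
Proof.
exists (Pdiv.Ring.rdivp g (cyclo_poly int)), (Pdiv.Ring.rmodp g (cyclo_poly int)).
have gE := Pdiv.RingMonic.rdivp_eq cyclo_poly_monic g.
split=> //; first by rewrite {1}gE rmorphD rmorphM /= ev_cyclo_poly mulr0 add0r.
rewrite -{1}(size_cyclo_poly int) Pdiv.Ring.ltn_rmodpN0 //.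
by rewrite -size_poly_gt0 size_cyclo_poly prime_gt0.
Qed.

Lemma ev_eq0 g : ev g = 0 -> exists q, g = q * cyclo_poly int.
Proof.
have [q [r [-> -> szr]]] := ev_mod g => er; exists q.
suff -> : r = 0 by rewrite addr0.
apply/eqP/negPn/negP => r0.
suff : (p <= size r)%N by rewrite leqNgt szr.
have inj_int : injective (intr : int -> rat) by exact: intr_inj.
rewrite -(size_map_inj_poly inj_int (rmorph0 _)); apply: size_root_xi.
  rewrite /root -map_poly_comp (eq_map_poly (g := intr)) -?evE ?er //.
  by move=> i /=; rewrite ratr_int.
by rewrite -size_poly_eq0 size_map_inj_poly // size_poly_eq0.
Qed.

Lemma ev_sum (u : F -> int) :
  ev (\poly_(k < p) u k%:R) = \sum_i (u i)%:~R * chi i.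
Proof.
rewrite evE (@horner_coef_wide _ p); last first.
  by rewrite (leq_trans (size_poly _ _)) ?size_poly.
rewrite [RHS](eq_bigr (fun i : F => (u (val i)%:R)%:~R * chi (val i)%:R)); last first.
  by move=> i _; rewrite natr_Zp.
rewrite (sum_Fp (fun k => (u k%:R)%:~R * chi k%:R)); apply: eq_bigr => k _.
by rewrite coef_map coef_poly ltn_ord chi_nat.
Qed.

Lemma ev_chi g : exists u : F -> int, ev g = \sum_i (u i)%:~R * chi i.
Proof.
have [_ [r [_ -> szr]]] := ev_mod g; exists (fun i => r`_(val i)).
rewrite -ev_sum; congr (ev _); apply/polyP => k; rewrite coef_poly.
case: ltnP => [kp|pk]; first by rewrite /= val_Fp_nat // modn_small.
by rewrite nth_default // (leq_trans (ltnW szr)).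
Qed.

(** An integer polynomial of size at most [p] that vanishes at [xi] is a constant multiple of
    [1 + X + ... + X^(p-1)]. This rigidity underlies the Galois action, the parity argument and the
    analysis of units below. *)
Lemma chi_indep (u : F -> int) :
  \sum_i (u i)%:~R * chi i = 0 -> exists t, forall i, u i = t.
Proof.
rewrite -ev_sum => /ev_eq0[q qE]; exists q`_0 => i.
have szq : (size q <= 1)%N.
  have [->|q0] := eqVneq q 0; first by rewrite size_poly0.
  have := congr1 (fun g : {poly int} => size g) qE.
  rewrite size_Mmonic ?cyclo_poly_monic // size_cyclo_poly => szE.
  have := size_poly p (fun k => u k%:R); rewrite szE.
  rewrite -[X in (X <= _)%N -> _]subn1 leq_subLR [(size q + p)%N]addnC.
  by rewrite [(1 + p)%N]addnC leq_add2l.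
have := congr1 (fun g : {poly int} => g`_(val i)) qE.
have ip : (val i < p)%N by rewrite -[X in (_ < X)%N](Fp_cast p_prime) ltn_ord.
by rewrite /= {1}(size1_polyC szq) coefCM !coef_poly natr_Zp ip mulr1.
Qed.

Lemma ev_chi_nat a : ev ('X^(val (a : F))) = chi a.
Proof. by rewrite evE map_polyXn hornerXn. Qed.

Local Notation lam := (1 - 'X : {poly int}).

Lemma ev_lam : ev lam = 1 - xi R p.
Proof. by rewrite rmorphB rmorph1 evE map_polyX hornerX. Qed.

Lemma ev_lam_neq0 : ev lam != 0.
Proof.
rewrite ev_lam subr_eq0 eq_sym -[xi R p]expr1 -chi_nat chi_eq1.
by rewrite -[1%:R]/1 oner_eq0.
Qed.

Lemma horner_cyclo1 : (cyclo_poly int).[1] = p%:R.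
Proof.
rewrite horner_poly; under eq_bigr do rewrite mul1r expr1n.
by rewrite sumr_const card_ord.
Qed.

(** Reduction modulo [1 - xi] is evaluation at [1] modulo [p]: if [g(1) = k p], subtracting [k]
    times the cyclotomic polynomial, which is [0] at [xi] and [p] at [1], leaves a multiple of
    [1 - X]. The next lemma is the converse. *)
Lemma ev_lam_dvd g : (p %| g.[1])%Z -> exists w, ev g = ev lam * ev w.
Proof.
case/dvdzP => k gk.
have /factor_theorem[q qE] : root (g - k%:P * cyclo_poly int) 1.
  by rewrite /root !hornerE horner_cyclo1 gk /= natz subrr.
exists (- q); rewrite -rmorphM mulrN -mulNr opprB mulrC -qE rmorphB rmorphM /=.
by rewrite ev_cyclo_poly mulr0 subr0.
Qed.

Lemma ev_dvd_lam g w : ev g = ev lam * ev w -> (p %| g.[1])%Z.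
Proof.
move/eqP; rewrite -rmorphM -subr_eq0 -rmorphB => /eqP/ev_eq0[q /eqP].
rewrite subr_eq => /eqP ->; rewrite !hornerE horner_cyclo1.
by rewrite ?subrr ?mul0r ?addr0 natz dvdz_mull.
Qed.

(** Conjugation is [X |-> X^(p-1)], which does not change the value at [1]; hence it preserves
    divisibility by [1 - xi]. *)
Lemma ev_conj g : exists2 g', ev g' = (ev g)^* & g'.[1] = g.[1].
Proof.
exists (g \Po 'X^(p.-1)); last by rewrite horner_comp hornerXn expr1n.
rewrite !evE map_comp_poly map_polyXn horner_comp hornerXn.
have -> : xi R p ^+ p.-1 = (xi R p)^*.
  rewrite -[xi R p in RHS]expr1 -!chi_nat chi_conj; congr (chi _).
  apply/eqP; rewrite -addr_eq0 natr1 prednK ?prime_gt0 //.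
  by rewrite (pcharf0 (pchar_Fp p_prime)).
rewrite -horner_map -map_poly_comp; congr (_.[_]); apply: eq_map_poly => i /=.
by rewrite rmorph_int.
Qed.

Lemma ev_lam_normsq g w : ev g * (ev g)^* = ev lam * ev w ->
  exists g', ev g = ev lam * ev g'.
Proof.
have [h <- h1] := ev_conj g; rewrite -rmorphM => /ev_dvd_lam.
rewrite hornerM h1 => pg; apply: ev_lam_dvd.
by move: pg; rewrite !dvdzE abszM Euclid_dvdM // orbb.
Qed.

Lemma p_prod : p%:R = \prod_(1 <= i < p) (1 - xi R p ^+ i) :> C.
Proof.
have /eqP := factor_Xn_sub_1 xi_prim_root.
rewrite big_ltn ?prime_gt0 // expr0 subrX1 polyC1.
rewrite (inj_eq (mulfI _)) ?polyXsubC_eq0 // => /eqP/(congr1 (horner^~ 1)).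
rewrite horner_prod horner_sum => h.
transitivity (\prod_(1 <= i < p) ('X - (xi R p ^+ i)%:P).[1]); last first.
  by apply: eq_bigr => i _; rewrite !hornerE.
rewrite h; under eq_bigr do rewrite hornerXn expr1n.
by rewrite sumr_const card_ord.
Qed.

(** Each [1 - xi^i] with [0 < i < p] is associate to [1 - xi]: the quotient is a geometric sum, and
    so is the inverse quotient, because [xi = (xi^i)^j] for [j] inverse to [i] modulo [p]. *)
Lemma p_lam : exists v v', p%:R = ev lam ^+ p.-1 * ev v /\
  ev lam ^+ p.-1 = p%:R * ev v'.
Proof.
have geo (x : C) k : 1 - x ^+ k = (1 - x) * \sum_(i < k) x ^+ i.
  by rewrite -opprB subrX1 -mulNr opprB.
have evX k : ev 'X^k = xi R p ^+ k by rewrite evE map_polyXn hornerXn.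
exists (\prod_(1 <= i < p) \sum_(k < i) 'X^k).
exists (\prod_(1 <= i < p) \sum_(k < val ((i%:R : F)^-1)) 'X^(i * k)).
rewrite {1 2}p_prod !rmorph_prod -{1 2}[p.-1]subn1 -prodr_const_nat -!big_split /=.
split; apply: eq_big_nat => i /andP[i0 ip]; rewrite rmorph_sum /=.
  by under eq_bigr do rewrite evX; rewrite ev_lam -geo.
under eq_bigr do rewrite evX exprM; rewrite -geo -exprM ev_lam; congr (1 - _).
rewrite -chi_nat natrM natr_Zp divff -?(chi_nat 1) //.
by rewrite -(dvdn_pcharf (pchar_Fp p_prime)) gtnNdvd.
Qed.

(* Up to units, [p] is the [(p - 1)]-st power of [lam = 1 - xi], which is prime
   and associate to its conjugate; so each factor [lam * conj lam] of the norm of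
   [ev g] forces a factor [lam] of [ev g]. *)
Lemma ev_descent m g : ev g * (ev g)^* = (p ^ (m * 2))%:R ->
  exists w, ev g = (p ^ m)%:R * ev w.
Proof.
move=> gE; have [v [v' [pE lE]]] := p_lam.
have [l' l'E _] := ev_conj lam; have [w' w'E _] := ev_conj v.
have step k : (k <= p.-1 * m)%N -> exists w, ev g = ev lam ^+ k * ev w.
  elim: k => [|k IHk] km; first by exists g; rewrite mul1r.
  have [w wE] := IHk (ltnW km).
  suff /ev_lam_normsq[w2 w2E] : ev w * (ev w)^* = ev lam *
     ev (lam ^+ (p.-1 * m - k.+1) * l' ^+ (p.-1 * m - k) * v ^+ m * w' ^+ m).
    by exists w2; rewrite wE w2E mulrA exprSr.
  have pmE : (p ^ m)%:R = ev lam ^+ (p.-1 * m) * ev v ^+ m.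
    by rewrite natrX pE exprMn -exprM.
  have pmC : (p ^ m)%:R = ev l' ^+ (p.-1 * m) * ev w' ^+ m.
    rewrite l'E w'E -(rmorph_nat Num.conj) pmE rmorphM.
    by rewrite ![in LHS]rmorphXn.
  have ll0 : (ev lam * (ev lam)^*) ^+ k != 0.
    by rewrite expf_neq0 // mulf_neq0 ?conjC_eq0 ?ev_lam_neq0.
  have [d dE] : exists d, (p.-1 * m)%N = (k + d.+1)%N.
    by exists (p.-1 * m - k.+1)%N; rewrite addnS -addSn subnKC.
  apply: (mulfI ll0); rewrite exprMn -l'E dE.
  rewrite addKn subnS addKn !rmorphM !rmorphXn /=.
  transitivity (ev g * (ev g)^*).
    by rewrite wE rmorphM rmorphXn /= l'E; ring.
  rewrite gE expnM expnSr expn1 natrM {1}pmE pmC dE !exprD exprS.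
  by ring.
have [w wE] := step _ (leqnn _); exists (v' ^+ m * w).
by rewrite wE exprM lE exprMn natrX rmorphM rmorphXn mulrA.
Qed.

Lemma autocorrelation (u : F -> int) :
  let z := \sum_i (u i)%:~R * chi i in
  z * z^* = \sum_k (\sum_i u (i + k) * u i)%:~R * chi k.
Proof.
rewrite /= rmorph_sum /= mulr_suml.
transitivity (\sum_i \sum_j (u i * u j)%:~R * chi (i - j)).
  apply: eq_bigr => i _; rewrite mulr_sumr; apply: eq_bigr => j _.
  by rewrite rmorphM /= rmorph_int chi_conj mulrACA -chiD -intrM.
rewrite exchange_big /=.
under [RHS]eq_bigr => k _ do rewrite rmorph_sum mulr_suml.
rewrite [RHS]exchange_big /=; apply: eq_bigr => j _.
rewrite (reindex_inj (addrI j)) /=; apply: eq_bigr => k _.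
by rewrite [j + k - j]addrAC subrr add0r.
Qed.

(** By [chi_indep] all autocorrelation coefficients equal one integer [t], except the one at [0],
    which is [1 + t]. That one is the sum of squares; all of them together add up to the square of
    the sum. *)
Lemma unit_autocorrelation (u : F -> int) :
  let z := \sum_i (u i)%:~R * chi i in
  z * z^* = 1 -> exists t, (\sum_i u i) ^+ 2 = 1 + p%:R * t
                        /\ \sum_i u i ^+ 2 = 1 + t.
Proof.
rewrite /= autocorrelation => hz.
pose A k := \sum_i u (i + k) * u i.
have [|t tE] := @chi_indep (fun k => A k - (k == 0)%:R).
  under eq_bigr do rewrite rmorphB mulrBl.
  rewrite sumrB hz (bigD1 0) //= big1 ?addr0 ?mul1r ?chi0 ?subrr // => i /negPf ->.
  by rewrite mul0r.
exists t; split; last first.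
  by rewrite -(tE 0) addrC subrK; apply: eq_bigr => i _; rewrite addr0 expr2.
have -> : (\sum_i u i) ^+ 2 = \sum_k A k.
  rewrite expr2 mulr_sumr exchange_big /=; apply: eq_bigr => j _.
  rewrite mulr_suml (reindex_inj (addrI j)) /=; apply: eq_bigr => k _.
  by rewrite addrC.
rewrite (eq_bigr (fun k => t + (k == 0)%:R)); last first.
  by move=> k _; rewrite -(tE k) subrK.
rewrite big_split /= sumr_const card_Fp // mulr_natl addrC; congr (_ + _).
by rewrite (bigD1 0) //= big1 ?addr0 // => i /negPf ->.
Qed.

(* Adding a constant to all coefficients [u i] does not change the element and
   changes their sum by a multiple of [p].  As that sum is [1] or [-1] modulo [p],
   it can be made equal to [1] or [-1]; then the squares of the coefficients sum
   to [1]. *)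
Lemma unit_Zxi g : ev g * (ev g)^* = 1 ->
  exists j, ev g = chi j \/ ev g = - chi j.
Proof.
have [u uE] := ev_chi g; rewrite uE => hz.
have shift c : \sum_i (u i - c)%:~R * chi i = \sum_i (u i)%:~R * chi i.
  under eq_bigr do rewrite rmorphB mulrBl.
  rewrite sumrB -mulr_sumr.
  have := sum_chi 1; under eq_bigr do rewrite mulr1; rewrite oner_eq0 => ->.
  by rewrite mulr0 subr0.
have [t [sE _]] := unit_autocorrelation hz.
have [c cE] : exists c, (\sum_i (u i - c)) ^+ 2 = 1.
  have : (p %| (\sum_i u i - 1) * (\sum_i u i + 1))%Z.
    have -> : (\sum_i u i - 1) * (\sum_i u i + 1) = p%:R * t.
      by rewrite -subr_sqr sE expr1n addrAC subrr add0r.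
    by rewrite natz dvdz_mulr.
  rewrite !dvdzE abszM Euclid_dvdM // -!dvdzE => /orP[]/dvdzP[c cE].
    exists c; rewrite sumrB sumr_const card_Fp //.
    have -> : \sum_i u i = c * p + 1 by rewrite -cE subrK.
    by rewrite -mulr_natr natz addrAC subrr add0r expr1n.
  exists c; rewrite sumrB sumr_const card_Fp //.
  have -> : \sum_i u i = c * p - 1 by rewrite -cE addrK.
  by rewrite -mulr_natr natz addrAC subrr add0r sqrrN expr1n.
have [|t' [s'E qE]] := @unit_autocorrelation (fun i => u i - c).
  by rewrite shift.
have t0 : t' = 0.
  move: s'E; rewrite cE => /eqP; rewrite addrC -subr_eq subrr eq_sym mulf_eq0.
  by rewrite pnatr_eq0 -[(p == 0)%N]negbK -lt0n prime_gt0 //= => /eqP.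
pose w i := u i - c.
have {qE} w1 : \sum_i w i ^+ 2 = 1 by rewrite qE t0 addr0.
have -> : \sum_i (u i)%:~R * chi i = \sum_i (w i)%:~R * chi i by rewrite -(shift c).
clearbody w.
have [j wj] : exists j, w j != 0.
  apply/existsP; apply: contraPT w1; rewrite negb_exists => /forallP w0.
  by rewrite big1 // => i _; move/negPn/eqP: (w0 i) => ->; rewrite expr0n.
have wge i : 0 <= w i ^+ 2 by rewrite sqr_ge0.
have wj1 : 1 <= w j ^+ 2 by rewrite -gtz0_ge1 exprn_even_gt0.
move: w1; rewrite (bigD1 j) //= => w1.
have rest0 : \sum_(i | i != j) w i ^+ 2 = 0.
  apply/eqP; rewrite eq_le sumr_ge0 // andbT.
  by rewrite -(lerD2l (w j ^+ 2)) w1 addr0.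
have w0 i : i != j -> w i = 0.
  move=> ij; move/eqP: rest0; rewrite psumr_eq0 // => /allP/(_ i).
  by rewrite mem_index_enum ij /= sqrf_eq0 => /(_ isT)/eqP.
exists j; rewrite (bigD1 j) //= big1 ?addr0; last by move=> i ij; rewrite w0 // mul0r.
move: w1; rewrite rest0 addr0 => /eqP; rewrite sqrf_eq1 => /orP[]/eqP ->.
  by left; rewrite mul1r.
by right; rewrite mulN1r.
Qed.

Lemma ev_normsq m g : ev g * (ev g)^* = (p ^ (m * 2))%:R ->
  exists j, ev g = (p ^ m)%:R * chi j \/ ev g = - ((p ^ m)%:R * chi j).
Proof.
move=> gE; have [w wE] := ev_descent gE.
have pm0 : ((p ^ m)%:R : C) != 0.
  by rewrite pnatr_eq0 -lt0n expn_gt0 prime_gt0.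
have /unit_Zxi[j jE] : ev w * (ev w)^* = 1.
  apply: (mulfI (mulf_neq0 pm0 pm0)); rewrite mulr1 -[RHS]natrM -expnD addnn -muln2 -gE.
  by rewrite wE rmorphM rmorph_nat; ring.
by exists j; rewrite wE -mulrN; case: jE => ->; [left|right].
Qed.

(** * Character sums over level sets: Galois action and parity *)

Lemma sum_fibres (I : finType) (A : pred I) (h : I -> F) (G : F -> C) :
  \sum_(x | A x) G (h x) =
  \sum_i (#|[pred x | A x && (h x == i)]|%:Z)%:~R * G i.
Proof.
rewrite (partition_big h xpredT) //=; apply: eq_bigr => i _.
rewrite (eq_bigr (fun=> G i)) => [|x /andP[_ /eqP ->] //].
by rewrite sumr_const -mulr_natl.
Qed.

Lemma sum_chi_ev (I : finType) (A : pred I) (h : I -> F) :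
  \sum_(x | A x) chi (h x) = ev (\sum_(x | A x) 'X^(val (h x))).
Proof. by rewrite rmorph_sum; apply: eq_bigr => x _; rewrite /= ev_chi_nat. Qed.

Lemma chi_inj : injective chi.
Proof.
move=> a b ab; apply/eqP; rewrite -subr_eq0 -chi_eq1 chiD chiN ab divff //.
exact: chi_neq0.
Qed.

Lemma chi_neq_opp a b : chi a != - chi b.
Proof.
have chip c : chi c ^+ p = 1.
  by rewrite -[c]natr_Zp chi_nat exprAC (prim_expr_order xi_prim_root) expr1n.
apply/eqP => /(congr1 (fun z => z ^+ p)); rewrite exprNn !chip -signr_odd p_odd.
by rewrite expr1 mulN1r => /eqP; rewrite -addr_eq0 -mulr2n pnatr_eq0.
Qed.

Lemma sign_chi_inj (s t : bool) a b :
  (-1) ^+ s * chi a = (-1) ^+ t * chi b -> s = t /\ a = b.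
Proof.
case: s; case: t; rewrite ?expr1 ?expr0 ?mul1r ?mulN1r.
- by move=> /oppr_inj/chi_inj.
- by move=> h; have /eqP := chi_neq_opp b a; rewrite h.
- by move=> h; have /eqP := chi_neq_opp a b; rewrite h.
- by move=> /chi_inj.
Qed.

Lemma sum_delta (k : int) (j : F) (G : F -> C) :
  \sum_i (k * (i == j)%:R)%:~R * G i = k%:~R * G j.
Proof.
rewrite (bigD1 j) //= eqxx mulr1 big1 ?addr0 // => i /negPf ->.
by rewrite mulr0 mul0r.
Qed.

(* The action of the automorphism xi |-> xi ^ c of Q(xi). *)
Lemma sum_chi_galois (I : finType) (A : pred I) (h : I -> F) (k : int) j c :
  c != 0 -> \sum_(x | A x) chi (h x) = k%:~R * chi j ->
  \sum_(x | A x) chi (c * h x) = k%:~R * chi (c * j).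
Proof.
move=> c0; rewrite !(sum_fibres A h) (sum_fibres A h (fun i => chi (c * i))).
set N := fun i : F => _ => hN.
have [|t tE] := @chi_indep
    (fun i => #|[pred x | A x && (h x == i)]|%:Z - k * (i == j)%:R).
  under eq_bigr do rewrite rmorphB mulrBl.
  by rewrite sumrB sum_delta hN subrr.
rewrite -[RHS](sum_delta k j (fun i => chi (c * i))); apply/eqP.
rewrite -subr_eq0 -sumrB.
under eq_bigr => i _ do rewrite -mulrBl -rmorphB tE.
rewrite -mulr_sumr; have := sum_chi c; rewrite (negPf c0).
by under eq_bigr do rewrite mulrC; move=> ->; rewrite mulr0.
Qed.

(** With all terms on one side, the coefficients agree. As [p >= 3], some exponent [c] differs from
    [a] and [b] and has an even coefficient, whereas for [a != b] the coefficient at [a] is odd. *)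
Lemma chi_parity (s : F -> int) (m1 m2 : int) a b : ~~ (2 %| m1)%Z ->
  \sum_i (s i * 2)%:~R * chi i = m1%:~R * chi a + m2%:~R * chi b -> a = b.
Proof.
move=> m1_odd hs; apply/eqP/negPn/negP => ab.
have [|t tE] := @chi_indep
    (fun i => s i * 2 - m1 * (i == a)%:R - m2 * (i == b)%:R).
  under eq_bigr do rewrite !rmorphB !mulrBl.
  by rewrite !sumrB !sum_delta hs addrAC addrK subrr.
have [c /norP[ca cb]] : exists c, ~~ ((c == a) || (c == b)).
  apply/existsP; apply: contraTT p_gt2; rewrite negb_exists => /forallP hc.
  rewrite -leqNgt -(card_Fp p_prime) -cardsT (leq_trans _ (_ : #|[set a; b]| <= 2)%N) //.
    by apply/subset_leq_card/subsetP => x _; rewrite !inE; exact: negPn (hc x).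
  by rewrite cards2; case: (a != b).
have := tE c; have := tE a; rewrite eqxx (negPf ab) (negPf ca) (negPf cb).
rewrite !mulr0 !subr0 mulr1 => <- hsc; case/negP: m1_odd.
have -> : m1 = (s a - s c) * 2 by rewrite mulrBl hsc; ring.
exact: dvdz_mull.
Qed.

(** * Walsh transforms of bent functions *)

Section Bent.
Variables (n m : nat).
Hypothesis n_even : n = (m * 2)%N.
Local Notation V := 'rV[F]_n.

Lemma half_powE : half_pow R p n = (p ^ m)%:R.
Proof.
rewrite /half_pow n_even exprM sqrtr_sqr ger0_norm ?exprn_ge0 ?ler0n //.
by rewrite rmorphXn /= rmorph_nat natrX.
Qed.

Lemma muE : mu R p n = 1.
Proof.
rewrite /mu n_even mulnC expnM -modnXm.
have : (p ^ 2 %% 4 = 1)%N.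
  rewrite -modnXm; have := ltn_pmod p (isT : 0 < 4)%N.
  have := p_odd; rewrite -(odd_mod p (erefl : odd 4 = false)).
  by move: (p %% 4)%N => [|[|[|[|]]]].
by move=> ->; rewrite exp1n.
Qed.

(** For even [n] the factor [mu] is [1] and [half_pow] is the integer [p^m], so bentness is a norm
    equation in [Z[xi]] and [ev_normsq] applies. *)
Lemma walsh_dual (f : V -> F) : bent R f -> forall alpha,
  walsh R f alpha =
  (-1) ^+ (alpha \in Bminus R f) * (p ^ m)%:R * chi (dual R f alpha).
Proof.
move=> f_bent alpha; rewrite inE /Bminus /dual muE half_powE mul1r.
have [j jE] : exists j, walsh R f alpha = (p ^ m)%:R * chi j \/
    walsh R f alpha = - ((p ^ m)%:R * chi j).
  have := f_bent alpha; rewrite half_powE /walsh sum_chi_ev => hn.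
  by apply: ev_normsq; rewrite -normCK hn -natrX -expnM.
(* The second case is the default value of [dual]; it cannot occur, since [j] qualifies. *)
case: pickP => [k /= | /(_ j)/=]; last first.
  by case: jE => ->; rewrite eqxx ?orbT.
case/orP => /eqP ->.
  rewrite -addr_eq0 -mulr2n mulrn_eq0 /= mulf_eq0 (negPf (chi_neq0 _)) orbF.
  by rewrite pnatr_eq0 -[(_ == 0)%N]negbK -lt0n expn_gt0 prime_gt0 //= mul1r.
by rewrite eqxx expr1 -mulrA mulN1r.
Qed.

Lemma BplusE (f : V -> F) : bent R f -> Bplus R f = ~: Bminus R f.
Proof.
move=> f_bent; apply/setP => x; rewrite !inE.
have := walsh_dual f_bent x; rewrite inE muE half_powE mul1r.
have pm0 : ((p ^ m)%:R : C) != 0.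
  by rewrite pnatr_eq0 -lt0n expn_gt0 prime_gt0.
set w := walsh _ _ _; set z := chi _ => hw.
have z0 : (p ^ m)%:R * z != 0 by rewrite mulf_neq0 ?chi_neq0.
case: (eqVneq w (- _)) hw => [-> _|_]; last by rewrite mul1r => ->; rewrite eqxx.
by rewrite eq_sym -addr_eq0 -mulr2n mulrn_eq0 (negPf z0).
Qed.

End Bent.

Lemma coprime_pred_gt0 e : coprime e p.-1 -> (0 < e)%N.
Proof.
rewrite lt0n; apply: contraTneq => ->; rewrite /coprime gcd0n.
by rewrite -(subnKC p_gt2).
Qed.

(** A Bezout relation gives [d e = 1 + i (p - 1)], and [b^(1 + i (p - 1)) = b] for every [b], zero
    included. *)
Lemma pow_coprime_inv e : coprime e p.-1 ->
  exists2 d, coprime d p.-1 & forall b : F, (b ^+ e) ^+ d = b.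
Proof.
move=> e_cop; have e_gt0 := coprime_pred_gt0 e_cop.
have [d k dE _] := egcdnP p.-1 e_gt0; move: dE; rewrite (eqP e_cop) => dE.
have kP (b : F) i : b ^+ (i * p.-1 + 1) = b.
  elim: i => [|i IHi]; first by rewrite mul0n expr1.
  rewrite mulSn -addnA exprD IHi -exprSr prednK ?prime_gt0 //.
  by rewrite -{2}[b]expf_card card_Fp.
exists d; last by move=> b; rewrite -exprM mulnC dE kP.
have : coprime (d * e) p.-1 by rewrite dE /coprime gcdnC gcdnMDl gcdn1.
by rewrite coprimeMl => /andP[].
Qed.

(** * Pairs of mutually dual bent functions *)

Section DualPair.
Variables (n m : nat).
Hypothesis n_even : n = (m * 2)%N.
Local Notation V := 'rV[F]_n.
Local Notation P := ((p ^ m)%:R : C).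
Local Notation orth U := (perp [set x : V | x \in U]).

Lemma P_neq0 : P != 0.
Proof. by rewrite pnatr_eq0 -lt0n expn_gt0 prime_gt0. Qed.

Lemma P_sqr : (p ^ n)%:R = P * P.
Proof. by rewrite n_even expnM expnSr expn1 natrM. Qed.

Definition fourier (G : V -> C) (a : V) : C := \sum_x G x * chi (dot a x).

Lemma fourier_inv (G : V -> C) x :
  fourier (fourier G) x = (p ^ n)%:R * G (- x).
Proof.
rewrite /fourier; under eq_bigr do rewrite mulr_suml.
rewrite exchange_big /= (bigD1 (- x)) //= [X in _ + X]big1 ?addr0.
  under eq_bigr do rewrite -mulrA -chiD dotNr dotC addNr chi0 mulr1.
  by rewrite sumr_const card_mx card_Fp // mul1n mulr_natl.
move=> y yx; under eq_bigr do rewrite -mulrA -chiD (dotC x) -dotDr dotC.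
by rewrite -mulr_sumr sum_chi_dot addr_eq0 (negPf yx) mulr0.
Qed.

(* For [f] satisfying [f (a x) = a ^ h f x], this holds with [e] inverse to
   [h - 1] modulo [p - 1]; in this form it also passes to the dual of [f]. *)
Definition quasi_homogeneous (f : V -> F) : Prop :=
  exists2 e, coprime e p.-1 &
    forall b x, b != 0 -> f (b ^+ e *: x) = b ^+ e.+1 * f x.

(** Everything needed later, freed from the choice inside [dual] and symmetric in [f] and [g], so
    that each fact is proved once and used in both directions. The sign in [+ dot] is harmless
    because both functions are even. *)
Record dual_pair (f g : V -> F) (U W : {vspace V}) : Prop := DualPair {
  dual_pair_l : forall a,
    \sum_x chi (f x + dot a x) = (-1) ^+ (a \in U) * P * chi (g a);
  dual_pair_r : forall x,
    \sum_a chi (g a + dot x a) = (-1) ^+ (x \in W) * P * chi (f x);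
  dual_pair_l0 : f 0 = 0;
  dual_pair_r0 : g 0 = 0;
  dual_pair_lhom : quasi_homogeneous f;
  dual_pair_rhom : quasi_homogeneous g }.

Lemma dual_pair_sym f g U W : dual_pair f g U W -> dual_pair g f W U.
Proof. by case. Qed.

(** The exponent [e] is coprime to the even number [p - 1], hence odd; then [b = -1] gives the
    claim. *)
Lemma quasi_homogeneous_even f x : quasi_homogeneous f -> f (- x) = f x.
Proof.
case=> e e_cop /(_ (-1) x); rewrite oppr_eq0 oner_eq0 => /(_ isT).
have e_odd : odd e.
  apply: contraLR e_cop => e_even; rewrite /coprime.
  have : (2 %| gcdn e p.-1)%N.
    rewrite dvdn_gcd !dvdn2 e_even /=.
    by move: p_odd; rewrite -[in odd p](prednK (prime_gt0 p_prime)).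
  by case: eqP => // ->.
by rewrite exprS -signr_odd e_odd expr1 scaleN1r mulrNN !mul1r.
Qed.

(** Inverting the transform of [chi (g a)] moves the signs to the side of [f]. Only one relation is
    assumed, and [W] is any set, so that the lemma can also be used before the duality is known to
    be mutual. *)
Lemma sum_chi_signed (f g : V -> F) (W : {set V}) a :
  quasi_homogeneous g ->
  (forall x, \sum_a chi (g a + dot x a) = (-1) ^+ (x \in W) * P * chi (f x)) ->
  \sum_x (-1) ^+ (x \in W) * chi (f x + dot a x) = P * chi (g a).
Proof.
move=> g_hom sum_g; apply: (mulfI P_neq0); rewrite mulrA -P_sqr mulr_sumr.
rewrite -[a in RHS]opprK (quasi_homogeneous_even _ g_hom).
rewrite -(fourier_inv (fun a => chi (g a))) /fourier.
apply: eq_bigr => x _; rewrite chiD (dotC a) mulrCA mulrA mulrA.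
rewrite -sum_g; congr (_ * _).
by apply: eq_bigr => y _; rewrite chiD.
Qed.

Section Transforms.
Variables (f g : V -> F) (U W : {vspace V}).
Hypothesis fg : dual_pair f g U W.

(** Since [1 - (-1)^(x \in W)] is twice the indicator of [W], twice the sum is the unsigned
    transform minus the signed one. *)
Lemma sum_chi_sub a :
  \sum_(x in W) chi (f x + dot a x) = if a \in U then - (P * chi (g a)) else 0.
Proof.
have two_neq0 : (2 : C) != 0 by rewrite pnatr_eq0.
apply: (mulfI two_neq0).
have -> : 2 * \sum_(x in W) chi (f x + dot a x) =
    \sum_x chi (f x + dot a x) - \sum_x (-1) ^+ (x \in W) * chi (f x + dot a x).
  rewrite -sumrB mulr_sumr big_mkcond /=; apply: eq_bigr => x _.
  by case: (x \in W); rewrite ?expr1 ?expr0; ring.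
have -> : \sum_x (-1) ^+ (x \in W) * chi (f x + dot a x) = P * chi (g a).
  rewrite -(@sum_chi_signed f g [set x | x \in W] a (dual_pair_rhom fg)).
    by apply: eq_bigr => x _; rewrite inE.
  by move=> x; rewrite inE (dual_pair_r fg).
rewrite (dual_pair_l fg).
by case: (a \in U); rewrite ?expr1 ?expr0; ring.
Qed.

(** On [W] the factor [chi (dot x y)] is trivial, so the sum over [W] at [x] equals the one at [0],
    which is [- P]. Being nonzero it puts [x] in [U], and comparing values gives [chi (g x) = 1]. *)
Lemma orth_sub x : x \in orth W -> x \in U /\ g x = 0.
Proof.
move=> xW; have := sum_chi_sub x; rewrite (eq_bigr (fun y => chi (f y + dot 0 y))).
  rewrite sum_chi_sub mem0v (dual_pair_r0 fg) chi0 mulr1.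
  case: ifP => _ /eqP; last by rewrite oppr_eq0 (negPf P_neq0).
  rewrite eqr_opp -{1}[P]mulr1 (inj_eq (mulfI P_neq0)) eq_sym chi_eq1.
  by move=> /eqP.
move=> y yW; move: xW; rewrite inE => /forall_inP/(_ y); rewrite inE dot0l.
by move=> /(_ yW)/eqP ->.
Qed.

(** Poisson summation: the indicator of [U] has transform [#|U|] times the indicator of its
    orthogonal, and inversion returns the indicator of [U]. *)
Lemma sum_chi_orth a :
  \sum_(x in orth U) chi (dot a x) =
    if a \in U then (p ^ n)%:R / #|U|%:R else 0.
Proof.
have U0 : (#|U|%:R : C) != 0.
  by rewrite card_vspace pnatr_eq0 -lt0n expn_gt0 card_Fp ?prime_gt0.
apply: (mulfI U0).
transitivity ((p ^ n)%:R * ((- a \in U)%:R : C)); last first.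
  by rewrite memvN; case: (a \in U); rewrite ?mulr1 ?mulr0 // mulrC mulfVK.
rewrite -(fourier_inv (fun x => (x \in U)%:R)) /fourier mulr_sumr big_mkcond /=.
apply: eq_bigr => x _.
have -> : \sum_y (y \in U)%:R * chi (dot x y) = \sum_(y in U) chi (dot x y).
  rewrite [RHS]big_mkcond; apply: eq_bigr => y _.
  by case: (y \in U); rewrite ?mul1r ?mul0r.
by rewrite sum_chi_subspace; case: ifP; rewrite ?mul0r.
Qed.

End Transforms.

(** * Class functions and association schemes *)

Section ClassFunctions.
Variable k : nat.

(* [k = 2] separates squares from nonsquares among the nonzero values of [f],
   [k = 1] does not. *)
Definition similar (f : V -> F) (U W : {vspace V}) (x y : V) : Prop :=
  [/\ (x == 0) = (y == 0), (x \in W) = (y \in W),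
      (x \in orth U) = (y \in orth U) &
      exists2 a, a != 0 & f y = a ^+ k * f x].

Definition class_function f U W (G : V -> C) : Prop :=
  forall x y, similar f U W x y -> G x = G y.

Definition pow_invariant (psi : F -> C) : Prop :=
  forall a t, a != 0 -> psi (a ^+ k * t) = psi t.

(** Used with [A] equal to [W] or to the whole space. Expanding [psi] in characters of [F_p],
    frequency [0] leaves the sum controlled by the last hypothesis, and each frequency [c != 0] is a
    Galois image of the known sum. *)
Lemma fourier_pow_invariant (f g : V -> F) (U W : {vspace V}) (A : pred V)
    (s : V -> int) (psi : F -> C) :
  quasi_homogeneous g -> pow_invariant psi ->
  (forall a, \sum_(x | A x) chi (f x + dot a x) = (s a)%:~R * chi (g a)) ->
  (forall c a, c != 0 -> s (c *: a) = s a) ->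
  class_function g W U (fun a => (s a)%:~R) ->
  class_function g W U (fun a => \sum_(x | A x) chi (dot a x)) ->
  class_function g W U (fun a => \sum_(x | A x) psi (f x) * chi (dot a x)).
Proof.
move=> [e e_cop ge] psi_inv sum_f s_inv s_class A_class.
pose psih c := \sum_t psi t * chi (- (c * t)).
have psi_psih t : p%:R * psi t = \sum_c psih c * chi (c * t).
  under eq_bigr do rewrite mulr_suml.
  rewrite exchange_big (bigD1 t) //= [X in _ + X]big1 ?addr0.
    under eq_bigr do rewrite -mulrA -chiD addNr chi0 mulr1.
    by rewrite sumr_const card_Fp // mulr_natl.
  move=> u ut; under eq_bigr do rewrite -mulrA -chiD addrC -mulrBr.
  by rewrite -mulr_sumr sum_chi subr_eq0 eq_sym (negPf ut) mulr0.
have psih_inv : pow_invariant psih.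
  move=> a t a0; rewrite /psih [RHS](reindex_inj (mulfI (expf_neq0 k a0))) /=.
  by apply: eq_bigr => u _; rewrite psi_inv // mulrCA !mulrA.
have galois a c : c != 0 -> \sum_(x | A x) chi (c * f x + dot a x) =
    (s a)%:~R * chi (c * g (c^-1 *: a)).
  move=> c0; rewrite -(s_inv c^-1 a) ?invr_neq0 //.
  rewrite -(sum_chi_galois c0 (sum_f _)); apply: eq_bigr => x _.
  by rewrite mulrDr dotZl mulVKf.
pose T a := \sum_(c | c != 0) psih c * chi (c * g (c^-1 *: a)).
have sumE a : p%:R * \sum_(x | A x) psi (f x) * chi (dot a x) =
    psih 0 * \sum_(x | A x) chi (dot a x) + (s a)%:~R * T a.
  rewrite mulr_sumr; under eq_bigr do rewrite mulrA psi_psih mulr_suml.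
  rewrite exchange_big (bigD1 0) //=; congr (_ + _).
    by rewrite mulr_sumr; apply: eq_bigr => x _; rewrite mul0r chi0 mulr1.
  rewrite mulr_sumr; apply: eq_bigr => c c0.
  rewrite mulrCA -(galois _ _ c0) mulr_sumr.
  by apply: eq_bigr => x _; rewrite -mulrA -chiD.
have [d _ ed] := pow_coprime_inv e_cop.
have e_inj : injective (fun b : F => (b ^+ e)^-1).
  by move=> b b' /invr_inj eb; rewrite -(ed b) eb ed.
have e_gt0 := coprime_pred_gt0 e_cop.
(* With [c = b^(-e)], quasi-homogeneity turns [c g (c^-1 a)] into [b^(-e) b^(e+1) g a = b g a], so
   [a] enters only through [g a]. *)
have TE a : T a = \sum_(b | b != 0) psih (b ^+ e)^-1 * chi (b * g a).
  rewrite /T (reindex_inj e_inj) /=.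
  apply: eq_big => b; first by rewrite invr_eq0 expf_eq0 e_gt0.
  rewrite invr_eq0 expf_eq0 e_gt0 /= => b0.
  by rewrite invrK ge // exprSr mulrA mulKf ?expf_neq0.
move=> x y sxy; have p0 : (p%:R : C) != 0 by rewrite pnatr_eq0 -lt0n prime_gt0.
apply: (mulfI p0); rewrite !sumE (A_class _ _ sxy) (s_class _ _ sxy).
congr (_ + _ * _); rewrite !TE; case: sxy => _ _ _ [a a0 ->].
rewrite [LHS](reindex_inj (mulfI (expf_neq0 k a0))) /=.
apply: eq_big => b; first by rewrite mulf_eq0 (negPf (expf_neq0 k a0)).
(* As [(a^k)^e = (a^e)^k] is again a [k]-th power, [psih] is insensitive to it. *)
move=> b0; have -> : psih ((a ^+ k * b) ^- e) = psih (b ^- e).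
  rewrite -(psih_inv (a ^+ e)) ?expf_neq0 //; congr psih.
  by rewrite exprMn invfM mulrA exprAC divff ?mul1r // !expf_neq0.
have -> // : b * (a ^+ k * g x) = a ^+ k * b * g x.
by rewrite mulrCA mulrA.
Qed.

Lemma class_function_decomp f g U W G : dual_pair f g U W ->
  class_function f U W G -> exists a0 a1 psi1 psi2,
    [/\ pow_invariant psi1, pow_invariant psi2 & forall x,
     G x = a0 * (x == 0)%:R + a1 * (x \in orth U)%:R
         + (x \in W)%:R * psi1 (f x) + psi2 (f x)].
Proof.
move=> fg G_class.
(* This reads [G] at some point of [A] whose value under [f] lies in the class of [t]; the default
   [0] covers classes that [A] does not meet. *)
pose psi (A : pred V) t := odflt 0 (omap G
  [pick x | A x && [exists a, (a != 0) && (f x == a ^+ k * t)]]).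
have psi_inv A : pow_invariant (psi A).
  move=> a t a0; rewrite /psi; congr (odflt 0 (omap G _)); apply: eq_pick => x /=.
  congr (_ && _); apply/existsP/existsP => -[b /andP[b0 /eqP ->]].
    by exists (b * a); rewrite mulf_neq0 //= exprMn mulrA.
  exists (b / a); rewrite mulf_neq0 ?invr_neq0 //= exprMn mulrA exprVn mulfVK //.
  by rewrite expf_neq0.
have psiE (A : pred V) x : A x ->
    (forall y a, A y -> a != 0 -> f y = a ^+ k * f x -> similar f U W x y) ->
    psi A (f x) = G x.
  move=> Ax hA; rewrite /psi; case: pickP => [y /andP[Ay /existsP[a]]|/(_ x)] /=.
    by case/andP=> a0 /eqP fy; apply/esym/G_class/(hA y a).
  rewrite Ax /= => /negbT; rewrite negb_exists => /forallP/(_ 1).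
  by rewrite oner_eq0 expr1n mul1r eqxx.
pose psiN := psi (fun x => x \notin W).
pose psiW := psi (fun x => (x \in W) && (x \notin orth U)).
pose c1 := odflt 0 (omap G [pick x | (x \in orth U) && (x != 0)]).
have orth0 : 0 \in orth U by rewrite inE; apply/forall_inP => y _; rewrite dot0l.
have orthW x : x \in orth U -> x \in W /\ f x = 0.
  exact: orth_sub (dual_pair_sym fg) x.
(* The coefficients telescope along [{0}], the orthogonal of [U], [W] and the whole space; [f]
   vanishes on the first two, hence [psiW 0]. *)
exists (G 0 - c1), (c1 - psiW 0), (fun t => psiW t - psiN t), psiN.
split=> [a t a0| |x]; [by rewrite /psiW /psiN !psi_inv|exact: psi_inv|].
have [->|x0] := eqVneq x 0.
  by rewrite orth0 mem0v (dual_pair_l0 fg) !mulr1n; ring.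
have [xU|xU] := boolP (x \in orth U).
  have [xW fx0] := orthW x xU; rewrite xW fx0.
  suff -> : c1 = G x by rewrite !mulr1n mulr0n; ring.
  rewrite /c1; case: pickP => [y /andP[yU y0]|/(_ x)] /=; last by rewrite xU x0.
  apply: G_class; have [yW fy0] := orthW y yU.
  split; rewrite ?(negPf x0) ?(negPf y0) ?xW ?yW ?xU ?yU //.
  by exists 1; rewrite ?oner_eq0 // fx0 fy0 mulr0.
have [xW|xW] := boolP (x \in W).
  suff -> : psiW (f x) = G x by rewrite !mulr1n !mulr0n; ring.
  apply: psiE => [|y a /andP[yW yU] a0 fy]; first by rewrite xW.
  split; rewrite ?xW ?yW ?(negPf xU) ?(negPf yU) //; last by exists a.
  by rewrite (negPf x0); apply/esym/negbTE; apply: contraNneq yU => ->.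
suff -> : psiN (f x) = G x by rewrite !mulr0n; ring.
apply: psiE => // y a yW a0 fy.
have yU : y \notin orth U by apply: contra yW => /orthW[].
split; rewrite ?(negPf xW) ?(negPf yW) ?(negPf xU) ?(negPf yU) //; last by exists a.
by rewrite (negPf x0); apply/esym/negbTE; apply: contraNneq yU => ->.
Qed.

Lemma fourier_class_function f g U W G : dual_pair f g U W ->
  class_function f U W G -> class_function g W U (fourier G).
Proof.
move=> fg G_class.
have [a0 [a1 [psi1 [psi2 [inv1 inv2 GE]]]]] := class_function_decomp fg G_class.
have g_hom := dual_pair_rhom fg.
have class1 : class_function g W U
    (fun a => \sum_(x in W) psi1 (f x) * chi (dot a x)).
  apply: (@fourier_pow_invariant f g U W (fun x => x \in W)
      (fun a => if a \in U then - ((p ^ m)%:Z) else 0)) => //.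
  - move=> a; rewrite (sum_chi_sub fg); case: ifP => _; last by rewrite mul0r.
    by rewrite rmorphN mulNr.
  - by move=> c a c0; rewrite rpredZeq (negPf c0).
  - by move=> x y [_ -> _ _].
  - by move=> x y [_ _ xy _]; rewrite !sum_chi_subspace xy.
have class2 : class_function g W U (fun a => \sum_x psi2 (f x) * chi (dot a x)).
  apply: (@fourier_pow_invariant f g U W xpredT
      (fun a => (-1) ^+ (a \in U) * (p ^ m)%:Z)) => //.
  - by move=> a; rewrite (dual_pair_l fg) rmorphM /= rmorph_sign.
  - by move=> c a c0; rewrite rpredZeq (negPf c0).
  - by move=> x y [_ -> _ _].
  - by move=> x y [xy _ _ _]; rewrite !sum_chi_dot xy.
have FE a : fourier G a = a0 + a1 * (\sum_(x in orth U) chi (dot a x))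
    + \sum_(x in W) psi1 (f x) * chi (dot a x) + \sum_x psi2 (f x) * chi (dot a x).
  rewrite /fourier; under eq_bigr do rewrite GE !mulrDl.
  rewrite !big_split /=; congr (_ + _ + _ + _).
  - rewrite (bigD1 0) //= eqxx dot0r chi0 !mulr1 big1 ?addr0 // => x /negPf ->.
    by rewrite mulr0 mul0r.
  - rewrite mulr_sumr [RHS]big_mkcond; apply: eq_bigr => x _.
    by case: (x \in orth U); rewrite ?mulr1 // mulr0 mul0r.
  - rewrite [RHS]big_mkcond; apply: eq_bigr => x _.
    by case: (x \in W); rewrite ?mul1r // !mul0r.
move=> x y sxy; rewrite !FE (class1 _ _ sxy) (class2 _ _ sxy) !sum_chi_orth.
by case: sxy => _ -> _ _.
Qed.

Lemma similar_opp f g U W x y : dual_pair f g U W ->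
  similar f U W x y -> similar f U W (- x) (- y).
Proof.
move=> fg [xy0 xyW xyU [a a0 fy]].
have orthN z : (- z \in orth U) = (z \in orth U).
  rewrite !inE; apply/forall_inP/forall_inP => h t tU; move: (h t tU);
    by rewrite dotNl oppr_eq0.
split; rewrite ?oppr_eq0 ?memvN ?orthN //.
by exists a; rewrite ?(quasi_homogeneous_even _ (dual_pair_lhom fg)).
Qed.

Definition convolution (G H : V -> C) x := \sum_z G (x - z) * H z.

Lemma fourier_convolution G H a :
  fourier (convolution G H) a = fourier G a * fourier H a.
Proof.
rewrite /fourier /convolution; under eq_bigr do rewrite mulr_suml.
rewrite exchange_big mulr_sumr /=; apply: eq_bigr => z _.
rewrite mulr_suml (reindex_inj (addIr z)) /=; apply: eq_bigr => x _.
by rewrite addrK dotDr chiD mulrACA.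
Qed.

Lemma convolution_class_function f g U W G H : dual_pair f g U W ->
  class_function f U W G -> class_function f U W H ->
  class_function f U W (convolution G H).
Proof.
move=> fg G_class H_class x y sxy.
have pn0 : ((p ^ n)%:R : C) != 0 by rewrite P_sqr mulf_neq0 // P_neq0.
(* A double transform reflects the argument, so [x] is written as [- (- x)]; the transform of a
   convolution is a product of class functions for [g], and the second transform leads back to
   [f]. *)
rewrite -[x]opprK -[y]opprK; apply: (mulfI pn0); rewrite -!fourier_inv.
apply: (fourier_class_function (dual_pair_sym fg)); last exact: similar_opp fg sxy.
move=> a b sab; rewrite !fourier_convolution.
by rewrite (fourier_class_function fg G_class sab) (fourier_class_function fg H_class sab).
Qed.

(** Numbering the parts by [cls] lets one proof serve all four tuples: it remains to check that
    equal numbers mean similar vectors. *)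
Lemma scheme_of_classes f g U W d (T : d.+1.-tuple {set V}) (cls : V -> nat) :
  dual_pair f g U W ->
  (forall x (i : 'I_d.+1), (x \in tnth T i) = (cls x == i)) ->
  (forall x, cls x < d.+1)%N -> (forall i : 'I_d.+1, exists x, cls x = i) ->
  (forall x, (cls x == 0%N) = (x == 0)) ->
  (forall x y, cls x = cls y -> similar f U W x y) ->
  (forall x y, similar f U W x y -> cls x = cls y) ->
  tuple_partition T /\ induces_symmetric_scheme d T.
Proof.
move=> fg TE cls_lt cls_onto cls0 cls_sim sim_cls.
have partT : tuple_partition T.
  apply: indexed_partition => [i|x|i j x].
    by have [x xi] := cls_onto i; exists x; rewrite TE xi.
    by exists (Ordinal (cls_lt x)); rewrite TE.
  by rewrite !TE => /eqP -> /eqP/val_inj.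
have T0 : tnth T ord0 = [set 0] by apply/setP => x; rewrite TE inE cls0.
have clsN x : cls (- x) = cls x.
  apply/esym/sim_cls; split; rewrite ?oppr_eq0 ?memvN //; last first.
    exists 1; rewrite ?oner_eq0 // expr1n mul1r.
    by rewrite (quasi_homogeneous_even _ (dual_pair_lhom fg)).
  rewrite !inE; apply/forall_inP/forall_inP => h t tU; move: (h t tU);
    by rewrite dotNl oppr_eq0.
have mapE i : tnth (map_tuple (@diff_rel p n) T) i = diff_rel (tnth T i).
  by rewrite tnth_map.
have trE i : rel_transpose (diff_rel (tnth T i)) = diff_rel (tnth T i).
  by apply/setP => -[x y]; rewrite !inE /= !TE -clsN opprB.
split=> //; split=> //; split; last by move=> i; rewrite mapE.
split.
- apply: indexed_partition => [i|[x y]|i j [x y]].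
  + have [x xi] := cls_onto i; exists (x, 0).
    by rewrite mapE inE subr0 TE xi.
  + by exists (Ordinal (cls_lt (x - y))); rewrite mapE inE TE.
  + by rewrite !mapE !inE !TE => /eqP -> /eqP/val_inj.
- apply/setP => -[x y]; rewrite mapE T0 !inE /=.
  by rewrite subr_eq0.
- by move=> i; exists i; rewrite mapE.
move=> u v w; have [w0 w0w] := cls_onto w.
(* The intersection number is taken at a representative [w0] of class [w]. In general, after
   [z |-> z - y], it is the convolution of two indicators at [x - y], which depends only on the
   class of [x - y]. *)
exists #|[set z | (w0 - z \in tnth T u) && (z \in tnth T v)]| => x y.
rewrite !mapE inE TE /= => /eqP xyw.
pose ind i (z : V) : C := (z \in tnth T i)%:R.
have ind_class i : class_function f U W (ind i).
  by move=> a b /sim_cls ab; rewrite /ind !TE ab.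
have convE a : convolution (ind u) (ind v) a =
    (#|[set z | (a - z \in tnth T u) && (z \in tnth T v)]|)%:R.
  rewrite /convolution /ind -sum1_card natr_sum [RHS]big_mkcond /=.
  by apply: eq_bigr => z _; rewrite !inE -natrM mulnb; case: (_ && _).
have : convolution (ind u) (ind v) (x - y) = convolution (ind u) (ind v) w0.
  by apply: (convolution_class_function fg) => //; apply: cls_sim; rewrite xyw.
rewrite !convE => /eqP; rewrite eqr_nat => /eqP <-.
rewrite -(card_imset _ (addIr (- y))) /=; apply: eq_card => z; rewrite !inE.
apply/imsetP/idP => [[t]|].
  by rewrite !inE /= => /andP[xt ty] ->; rewrite opprB addrA subrK xt ty.
move=> /andP[h1 h2]; exists (z + y); last by rewrite addrK.
by rewrite !inE /= addrK h2 andbT [z + y]addrC opprD addrA h1.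
Qed.

End ClassFunctions.

(** * Sizes of the level sets *)

Section Counting.

(** An integral sum is fixed by the Galois action, so it stays equal to [k] when [f] is replaced by
    [c f] with [c != 0]; orthogonality on [F_p] then yields the size of every level set. *)
Lemma count_level (f : V -> F) (A : pred V) (k : int) j :
  \sum_(x | A x) chi (f x) = k%:~R ->
  (p * #|[pred x | A x && (f x == j)]|)%:Z =
  #|A|%:Z + k * ((p * (j == 0%R))%:Z - 1).
Proof.
move=> sum_f.
have sum_c c : c != 0 -> \sum_(x | A x) chi (c * f x) = k%:~R.
  move=> c0; have := @sum_chi_galois _ A f k 0 c c0.
  by rewrite mulr0 chi0 !mulr1; apply.
apply: (@intr_inj C); rewrite rmorphD rmorphM rmorphB /=.
transitivity (\sum_(x | A x) \sum_c chi (c * (f x - j))).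
  rewrite -pmulrn natrM -sum1_card natr_sum mulr_sumr big_mkcondr /=.
  apply: eq_bigr => x _; rewrite sum_chi subr_eq0; case: ifP => //.
  by rewrite mulr1.
rewrite exchange_big (bigD1 0) //=; congr (_ + _).
  by under eq_bigr do rewrite mul0r chi0; rewrite sumr_const.
transitivity (\sum_(c | c != 0) k%:~R * chi (c * - j)).
  apply: eq_bigr => c c0; rewrite -(sum_c c c0) mulr_suml.
  by apply: eq_bigr => x _; rewrite -chiD mulrDr.
rewrite -mulr_sumr; congr (_ * _).
have := sum_chi (- j); rewrite (bigD1 0) //= mul0r chi0 oppr_eq0 => hs.
apply/eqP; rewrite eq_sym subr_eq addrC hs.
by rewrite -pmulrn; case: (j == 0); rewrite ?muln1 ?muln0.
Qed.

Variables (f g : V -> F) (U W : {vspace V}) (r : nat).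
Hypotheses (fg : dual_pair f g U W) (dimU : \dim U = r) (dimW : \dim W = r).

Lemma card_level_in j :
  (p * #|[pred x | (x \in W) && (f x == j)]|)%:Z =
  (p ^ r)%:Z - (p ^ m)%:Z * ((p * (j == 0))%:Z - 1).
Proof.
rewrite (@count_level f _ (- (p ^ m)%:Z)) ?mulNr.
  by rewrite card_vspace dimW card_Fp.
rewrite rmorphN /=; have := sum_chi_sub fg 0.
rewrite mem0v (dual_pair_r0 fg) chi0 mulr1 => <-.
by apply: eq_bigr => x _; rewrite dot0l addr0.
Qed.

(** At frequency [0] the sums over the whole space and over [W] are both [- P], so the sum over the
    complement vanishes and its level sets all have the same size. *)
Lemma card_level_out j :
  (p * #|[pred x | (x \notin W) && (f x == j)]|)%:Z = (p ^ n)%:Z - (p ^ r)%:Z.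
Proof.
rewrite (@count_level f _ 0) ?mul0r ?addr0.
  have := cardC (mem W).
  rewrite card_vspace dimW card_Fp // card_mx card_Fp // mul1n => <-.
  by rewrite PoszD addrAC subrr add0r.
have := sum_chi_sub fg 0; rewrite mem0v (dual_pair_r0 fg) chi0 mulr1 => sumW.
have sumV : \sum_x chi (f x + dot 0 x) = - P.
  by rewrite (dual_pair_l fg) mem0v (dual_pair_r0 fg) chi0 mulr1 expr1 mulN1r.
move: sumV; rewrite (bigID (fun x => x \in W)) /= sumW -[RHS]addr0 => /addrI.
move=> sumN; rewrite -[RHS]/(0 : C) -[RHS]sumN.
by apply: eq_bigr => x _; rewrite dot0l addr0.
Qed.

Lemma card_orth : #|orth U| = (p ^ (n - r))%N.
Proof.
have rn : (r <= n)%N.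
  by rewrite -dimU; have := dimvS (subvf U); rewrite dimvf /dim /= mul1n.
apply/eqP; rewrite -(eqr_nat C); apply/eqP.
have := sum_chi_orth U 0; rewrite mem0v card_vspace dimU card_Fp // natrX.
under eq_bigr do rewrite dot0l chi0; rewrite sumr_const => ->.
rewrite -{1}(subnK rn) natrX exprD mulfK ?natrX //.
by rewrite expf_neq0 // pnatr_eq0 -lt0n prime_gt0.
Qed.

End Counting.

(** * The dual of a function in DBF *)

Section Existence.

Lemma walsh_even (f : V -> F) a : bent R f -> quasi_homogeneous f ->
  \sum_x chi (f x + dot a x) =
  (-1) ^+ (a \in Bminus R f) * P * chi (dual R f a).
Proof.
move=> f_bent f_hom; rewrite -(walsh_dual n_even f_bent) /walsh.
rewrite (reindex_inj oppr_inj); apply: eq_bigr => x _.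
by rewrite (quasi_homogeneous_even _ f_hom) dotNr.
Qed.

Variable f : V -> F.
Hypotheses (f_bent : bent R f) (g_bent : bent R (dual R f)) (f_DBF : DBF R f).
Local Notation g := (dual R f).

(** For [f], let [d] be inverse to [h - 1] modulo [p - 1]; scaling by [b^d] multiplies [f] by
    [b^(d h) = b^(d+1)]. For the dual, apply [xi |-> xi^(b^h)] to the transform at [a]: as
    [b^h f x = f (b x)], reindexing gives the transform at [b^(h-1) a], so the exponent is
    [h - 1]. *)
Lemma DBF_homogeneous : quasi_homogeneous f /\ quasi_homogeneous g.
Proof.
have [_ _ [h [h0 h_cop fh]]] := f_DBF.
rewrite subn1 subn1 in h_cop.
have f_hom : quasi_homogeneous f.
  have [d d_cop bd] := pow_coprime_inv h_cop; exists d => // b x b0.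
  rewrite fh ?expf_neq0 //; congr (_ * _).
  by rewrite -{1}(prednK h0) [LHS]exprS exprAC bd exprSr.
split=> //; exists h.-1 => // b a b0; rewrite prednK //.
have bh0 : b ^+ h != 0 by rewrite expf_neq0.
have := walsh_even a f_bent f_hom.
have -> : (-1) ^+ (a \in Bminus R f) * P =
    ((-1) ^+ (a \in Bminus R f) * (p ^ m)%:Z)%:~R :> C.
  by rewrite rmorphM /= rmorph_sign.
move=> /(sum_chi_galois bh0).
have -> : \sum_x chi (b ^+ h * (f x + dot a x)) =
    \sum_x chi (f x + dot (b ^+ h.-1 *: a) x).
  have bK : injective (fun x : V => b *: x) by apply: scalerI.
  rewrite [RHS](reindex_inj bK); apply: eq_bigr => x _.
  by rewrite fh // mulrDr dotZl dotZr mulrA -exprSr prednK.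
rewrite walsh_even // rmorphM /= rmorph_sign -!mulrA.
rewrite [_ * chi _]mulrC [X in _ = _ * X]mulrC !mulrA => /(mulIf P_neq0).
by case/sign_chi_inj.
Qed.

(* Twice the sum over [Bminus f] is [P] times the difference of two signed
   [p]-th roots of unity, with [P] odd; parity forces them to be equal up to sign. *)
Lemma dual_dual x : dual R g x = f x.
Proof.
have [f_hom g_hom] := DBF_homogeneous.
have h1 := @sum_chi_signed g f (Bminus R f) x f_hom (fun a => walsh_even a f_bent f_hom).
have h2 := walsh_even x g_bent g_hom.
apply: (@chi_parity
  (fun i => #|[pred a | (a \in Bminus R f) && (g a + dot x a == i)]|%:Z)
  ((-1) ^+ (x \in Bminus R g) * (p ^ m)%:Z) (- (p ^ m)%:Z)).
  by rewrite dvdzE abszMsign dvdn2 oddX p_odd orbT.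
under eq_bigr do rewrite rmorphM /= mulrAC.
rewrite -mulr_suml -(sum_fibres (fun a => a \in Bminus R f) (fun a => g a + dot x a)).
rewrite !rmorphM rmorph_sign rmorphN mulNr -h1 -h2 -sumrB mulr_suml big_mkcond.
apply: eq_bigr => a _; case: (a \in _); rewrite ?expr1 ?expr0; last by ring.
by rewrite -[2%:~R]/(2%:R : C); ring.
Qed.

(* As [f] is even, pairing [x] with [- x] shows that the Walsh value at 0 is
   congruent to 1 modulo 2. *)
Lemma dual0 : g 0 = 0.
Proof.
have [f_hom g_hom] := DBF_homogeneous.
have [_ f0 _] := f_DBF.
have h1 := walsh_even 0 f_bent f_hom.
pose A (x : V) := (enum_rank x < enum_rank (- x)%R)%N.
apply: (@chi_parity (fun i => #|[pred x | A x && (f x == i)]|%:Z)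
  ((-1) ^+ (0 \in Bminus R f) * (p ^ m)%:Z) (- 1)).
  by rewrite dvdzE abszMsign dvdn2 oddX p_odd orbT.
under eq_bigr do rewrite rmorphM /= mulrAC.
rewrite -mulr_suml -(sum_fibres A f) rmorphM rmorph_sign -h1 rmorphN1 mulN1r.
have opp_neq x : x != 0 :> V -> - x != x.
  move=> x0; rewrite -subr_eq0 -opprD oppr_eq0 -mulr2n -scaler_nat scaler_eq0.
  rewrite (negPf x0) orbF -(dvdn_pcharf (pchar_Fp p_prime)).
  by rewrite gtnNdvd.
have -> : \sum_x chi (f x + dot 0 x) = chi 0 + \sum_(x | x != 0) chi (f x).
  rewrite (bigD1 0) //= dot0r addr0 f0; congr (_ + _).
  by apply: eq_bigr => x _; rewrite dot0l addr0.
rewrite [RHS]addrAC subrr add0r [RHS](bigID A) /= -[2%:~R]/(2%:R : C).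
rewrite mulr_natr mulr2n; congr (_ + _).
  apply: eq_bigl => x; rewrite andbC; case Ax: (A x) => //=.
  by apply/esym; apply: contraTneq Ax => ->; rewrite /A oppr0 ltnn.
rewrite (reindex_inj oppr_inj) /=; apply: eq_big => x.
  rewrite /A opprK -leqNgt; case: (eqVneq x 0) => [->|x0].
    by rewrite oppr0 ltnn.
  by rewrite ltn_neqAle (inj_eq val_inj) (inj_eq enum_rank_inj) opp_neq.
by move=> _; rewrite (quasi_homogeneous_even _ f_hom).
Qed.

Lemma DBF_dual_pair (U W : {vspace V}) :
  Bminus R f = [set x | x \in U] -> Bminus R g = [set x | x \in W] ->
  dual_pair f g U W.
Proof.
move=> fU gW; have [f_hom g_hom] := DBF_homogeneous.
have [_ f0 _] := f_DBF.
split=> //; last exact: dual0.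
  by move=> a; rewrite walsh_even // fU inE.
by move=> x; rewrite walsh_even // dual_dual gW inE.
Qed.

End Existence.

End DualPair.

(** * Squares and nonsquares *)

Lemma Fp_gen : exists z : F, p.-1.-primitive_root z.
Proof.
have p1 : (0 < p.-1)%N by rewrite -(subnKC p_gt2).
have : has p.-1.-primitive_root (filter (predC1 (0 : F)) (enum F)).
  apply: has_prim_root => //.
  - apply/allP => x; rewrite mem_filter /= => /andP[x0 _].
    apply/unity_rootP; apply: (mulfI x0).
    by rewrite -exprS prednK ?prime_gt0 // mulr1 -{2}[x]expf_card card_Fp.
  - by rewrite filter_uniq // enum_uniq.
  - rewrite size_filter -(leq_add2l (count (pred1 (0 : F)) (enum F))) count_predC.
    rewrite -cardE card_Fp // count_uniq_mem ?enum_uniq // mem_enum.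
    by rewrite add1n prednK ?prime_gt0.
by case/hasP => z _ zp; exists z.
Qed.

Lemma Fp_prim_root_pow (z a : F) :
  p.-1.-primitive_root z -> a != 0 -> exists i, a = z ^+ i.
Proof.
move=> zp a0; have ap : a ^+ p.-1 = 1.
  apply: (mulfI a0).
  by rewrite -exprS prednK ?prime_gt0 // mulr1 -{2}[a]expf_card card_Fp.
by have [i ->] := prim_rootP zp ap; exists i.
Qed.

(** A generator of the cyclic group of order [p - 1] is not a square, because [2 i = 1] is
    impossible modulo the even number [p - 1]. *)
Lemma exists_NSQ : exists a : F, a \in NSQ p.
Proof.
have [z zp] := Fp_gen; have z0 : z != 0.
  apply/eqP => z0; have := prim_expr_order zp; rewrite z0 expr0n -(subnKC p_gt2) /=.
  by move/eqP; rewrite eq_sym oner_eq0.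
exists z; rewrite inE z0 /=; apply/negP => /existsP[b /eqP zb].
have b0 : b != 0 by apply: contraNneq z0 => b0; rewrite zb b0 expr0n.
have [i bi] := Fp_prim_root_pow zp b0.
have : z ^+ (i * 2) == z ^+ 1 by rewrite exprM -bi -zb expr1.
rewrite (eq_prim_root_expr zp) => /eqP/(congr1 odd).
have p1_even : ~~ odd p.-1 by move: p_odd; rewrite -{1}(prednK (prime_gt0 p_prime)).
by rewrite !odd_mod ?oddM ?andbF //; apply/negbTE.
Qed.

Lemma SQ1 : (1 : F) \in SQ p.
Proof.
by rewrite inE oner_eq0; apply/existsP; exists 1; rewrite expr1n.
Qed.

Lemma SQ_mul (a t : F) : a != 0 -> (a ^+ 2 * t \in SQ p) = (t \in SQ p).
Proof.
move=> a0; rewrite !inE mulf_eq0 expf_eq0 /= (negPf a0) /=; congr (_ && _).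
apply/existsP/existsP => -[b /eqP bE]; last first.
  by exists (a * b); rewrite bE exprMn.
by exists (b / a); rewrite exprMn exprVn -bE mulrAC divff ?mul1r // expf_neq0.
Qed.

Lemma square_class (s t : F) : (s == 0) = (t == 0) ->
  (s \in SQ p) = (t \in SQ p) -> exists2 a, a != 0 & t = a ^+ 2 * s.
Proof.
have [->|s0] := eqVneq s 0; have [->|t0] := eqVneq t 0 => // _ st.
  by exists 1; rewrite ?oner_eq0 ?mulr0.
(* If [t s = c^2], then [a = c / s] works. The product of two squares, or of two odd powers of a
   generator, is a square. *)
suff [c cE] : exists c, t * s = c ^+ 2.
  have c0 : c != 0.
    by have := mulf_neq0 t0 s0; apply: contraNneq => c0; rewrite cE c0 expr0n.
  exists (c / s); first by rewrite mulf_neq0 ?invr_neq0.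
  by rewrite exprMn -cE exprVn expr2 invfM mulrA mulfK // -mulrA mulVf // mulr1.
have [z zp] := Fp_gen.
have [i sE] := Fp_prim_root_pow zp s0; have [j tE] := Fp_prim_root_pow zp t0.
have sqE (k : nat) : z ^+ k \notin SQ p -> z ^+ k != 0 -> odd k.
  rewrite inE => + z0; rewrite z0 /=; apply: contraNT => k_even.
  apply/existsP; exists (z ^+ k./2); rewrite -exprM muln2.
  rewrite -[in X in X == _](odd_double_half k).
  by rewrite (negPf k_even).
have [tS|tN] := boolP (t \in SQ p); last first.
  exists (z ^+ (i + j)./2); rewrite -exprM muln2 sE tE -exprD addnC.
  rewrite -[in LHS](odd_double_half (i + j)) oddD.
  by rewrite !sqE -?tE -?sE // st.
move: st; rewrite tS inE.
move=> /andP[_ /existsP[b /eqP ->]]; move: tS; rewrite inE => /andP[_ /existsP[c /eqP ->]].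
by exists (c * b); rewrite exprMn.
Qed.
(** * The partitions U6, U7, U8, U9 *)

Section Families.
Variables (n m r : nat) (f : 'rV[F]_n -> F) (U W : {vspace 'rV[F]_n}).
Local Notation V := 'rV[F]_n.
Local Notation g := (dual R f).
Local Notation orth U := (perp [set x : V | x \in U]).
Hypotheses (n_even : n = (m * 2)%N) (r_lt : (r < n)%N).
Hypotheses (fg : dual_pair m f g U W) (dimU : \dim U = r) (dimW : \dim W = r).
Hypotheses (g_bent : bent R g) (fU : Bminus R f = [set x | x \in U]).
Hypothesis gW : Bminus R g = [set x | x \in W].

Let p_gt0 : (0 < p)%N := prime_gt0 p_prime.
Let p_gt1 : (1 < p)%N := prime_gt1 p_prime.

Lemma exists_out j : exists x, x \notin W /\ f x = j.
Proof.
have := card_level_out n_even fg dimW j.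
case: (pickP [pred x | (x \notin W) && (f x == j)]) => [x /andP[xW /eqP fx] _|h].
  by exists x.
rewrite (eq_card0 h) muln0 => /eqP; rewrite eq_sym subr_eq0 eqz_nat eqn_exp2l //.
by rewrite (gtn_eqF r_lt).
Qed.

Lemma exists_in j : j != 0 -> exists x, x \in W /\ f x = j.
Proof.
move=> /negPf j0; have := card_level_in n_even fg dimW j.
case: (pickP [pred x | (x \in W) && (f x == j)]) => [x /andP[xW /eqP fx] _|h].
  by exists x.
rewrite (eq_card0 h) j0 !muln0 sub0r mulrN1 opprK -PoszD => /eqP.
by rewrite eqz_nat eq_sym addn_eq0 expn_eq0 (gtn_eqF p_gt0).
Qed.

Lemma exists_orth : exists x : V, x \in orth U /\ x != 0.
Proof.
have : (1 < #|orth U|)%N by rewrite (card_orth dimU) -[1%N](expn0 p) ltn_exp2l // subn_gt0.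
rewrite (cardD1 0); case: (pickP [predD1 (mem (orth U)) & 0]) => [x /andP[x0 xU] _|h].
  by exists x.
by rewrite (eq_card0 h) addn0; case: (_ \in _).
Qed.

Lemma orth_in_level x : x \in orth U -> x \in W /\ f x = 0.
Proof. exact: (orth_sub n_even (dual_pair_sym fg)). Qed.

(** Otherwise the [N] zeros of [f] in [W] lie in the orthogonal of [U], so [p N <= p^(n-r+1) < p^m];
    but [p N = p^r - p^m (p - 1) >= p^m]. *)
Lemma exists_zero_not_orth : (m.+1 < r)%N ->
  exists x, [/\ x \in W, f x = 0 & x \notin orth U].
Proof.
move=> mr; have := card_level_in n_even fg dimW 0.
set N := #|_|; rewrite eqxx muln1 => NE.
case: (pickP [pred x | [&& x \in W, f x == 0 & x \notin orth U]])
  => [x /and3P[xW /eqP fx xU]|h].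
  by exists x.
have NU : (N <= #|orth U|)%N.
  apply/subset_leq_card/subsetP => x /andP[xW fx]; have := h x.
  by rewrite /= xW fx => /negbT/negPn.
have : (p * N <= p ^ (n - r).+1)%N by rewrite expnS leq_mul2l -(card_orth dimU) NU orbT.
have : (p ^ (n - r).+1 < p ^ m)%N.
  rewrite ltn_exp2l //; move: mr; rewrite n_even; lia.
have : (p ^ m.+1 <= p ^ r)%N by rewrite leq_exp2l // ltnW.
rewrite [(p ^ m.+1)%N]expnS; move: NE.
set a := (p * N)%N; set b := (p ^ r)%N; set c := (p ^ m)%N; set d := (p ^ _)%N.
nia.
Qed.

(** The orthogonal of [U] is contained in the zero level of [f] in [W], and for [r = m + 1] both
    have [p^(m-1)] elements. *)
Lemma zero_orth x : r = m.+1 -> x \in W -> f x = 0 -> x \in orth U.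
Proof.
move=> rm xW fx; have := card_level_in n_even fg dimW 0.
pose A := [set x | (x \in W) && (f x == 0)].
have sub : orth U \subset A.
  by apply/subsetP => y /orth_in_level[yW fy]; rewrite inE yW fy eqxx.
have -> : #|[pred x | (x \in W) && (f x == 0)]| = #|A|.
  by apply: eq_card => y; rewrite !inE.
rewrite eqxx muln1 rm => AE.
have cardA : #|A| = #|orth U|.
  have cU : (p * #|orth U|)%N = (p ^ m)%N.
    rewrite (card_orth dimU) -expnS; congr (p ^ _)%N; rewrite n_even rm; lia.
  apply/eqP; rewrite -(eqn_pmul2l p_gt0) cU; apply/eqP.
  move: AE; rewrite [(p ^ m.+1)%N]expnS.
  set a := (p * _)%N; set c := (p ^ m)%N; nia.
have /eqP -> : orth U == A by rewrite eqEcard sub cardA leqnn.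
by rewrite inE xW fx eqxx.
Qed.

Lemma mem_cset j x : (x \in cset R f j) = (x \notin W) && (f x == j).
Proof. by rewrite inE (BplusE n_even g_bent) gW !inE. Qed.

Lemma mem_dset j x : (x \in dset R f j) = (x \in W) && (f x == j).
Proof. by rewrite inE gW !inE. Qed.

Lemma mem_bigcup_cset (Q : pred F) x :
  (x \in \bigcup_(j | Q j) cset R f j) = (x \notin W) && Q (f x).
Proof.
apply/bigcupP/andP => [[j Qj]|[xW Qx]]; last by exists (f x); rewrite ?mem_cset ?xW /=.
by rewrite mem_cset => /andP[xW /eqP ->].
Qed.

Lemma mem_bigcup_dset (Q : pred F) x :
  (x \in \bigcup_(j | Q j) dset R f j) = (x \in W) && Q (f x).
Proof.
apply/bigcupP/andP => [[j Qj]|[xW Qx]]; last by exists (f x); rewrite ?mem_dset ?xW /=.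
by rewrite mem_dset => /andP[xW /eqP ->].
Qed.

Lemma mem_NSQ (t : F) : (t \in NSQ p) = (t != 0) && (t \notin SQ p).
Proof. by rewrite !inE; case: (t == 0). Qed.

(** Every part is a Boolean combination of five tests on [x]. These implications discard the
    impossible rows of the truth tables checked below. *)
Lemma level_implications x :
  [&& (x == 0) ==> (x \in orth U), (x \in orth U) ==> (x \in W) && (f x == 0)
    & (f x \in SQ p) ==> (f x != 0)].
Proof.
apply/and3P; split; apply/implyP.
- by move=> /eqP ->; rewrite inE; apply/forall_inP => y _; rewrite dot0l.
- by move=> /orth_in_level[-> ->]; rewrite eqxx.
- by rewrite inE => /andP[].
Qed.

Lemma similar2P x y : (x == 0) = (y == 0) -> (x \in W) = (y \in W) ->
  (x \in orth U) = (y \in orth U) -> (f x == 0) = (f y == 0) ->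
  (f x \in SQ p) = (f y \in SQ p) -> similar 2 f U W x y.
Proof. by move=> h1 h2 h3 h4 h5; split=> //; apply: square_class. Qed.

Lemma similar2E x y : similar 2 f U W x y ->
  [/\ (x == 0) = (y == 0), (x \in W) = (y \in W),
   (x \in orth U) = (y \in orth U), (f x == 0) = (f y == 0) &
   (f x \in SQ p) = (f y \in SQ p)].
Proof.
case=> h1 h2 h3 [a a0 ->]; split=> //; last by rewrite SQ_mul.
by rewrite mulf_eq0 expf_eq0 /= (negPf a0).
Qed.

Lemma similar1P x y : (x == 0) = (y == 0) -> (x \in W) = (y \in W) ->
  (x \in orth U) = (y \in orth U) -> (f x == 0) = (f y == 0) ->
  similar 1 f U W x y.
Proof.
move=> h1 h2 h3 h4; split=> //; move: h4.
have [->|fx0] := eqVneq (f x) 0; have [->|fy0] := eqVneq (f y) 0 => // _.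
  by exists 1; rewrite ?oner_eq0 ?mulr0.
by exists (f y / f x); rewrite ?mulf_neq0 ?invr_neq0 // expr1 mulfVK.
Qed.

Lemma similar1E x y : similar 1 f U W x y ->
  [/\ (x == 0) = (y == 0), (x \in W) = (y \in W),
   (x \in orth U) = (y \in orth U) & (f x == 0) = (f y == 0)].
Proof.
case=> h1 h2 h3 [a a0 ->]; split=> //.
by rewrite mulf_eq0 expf_eq0 /= (negPf a0).
Qed.

Ltac case_levels x :=
  move: (level_implications x);
  case: (x == 0); case: (x \in W); case: (x \in orth U);
  case: (f x == 0); case: (f x \in SQ p) => //.

Ltac mem_levels x :=
  rewrite ?in_set1 ?in_setD ?mem_cset ?mem_dset ?mem_bigcup_cset
    ?mem_bigcup_dset ?in_set1 /= ?mem_NSQ; case_levels x.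

Ltac class_of x xW fx j0 jS :=
  exists x; move: (level_implications x); rewrite xW fx;
  rewrite ?eqxx ?j0 ?jS;
  case: (x == 0); case: (x \in orth U) => //.

Lemma U6_scheme : r = m.+1 ->
  tuple_partition (U6 R f) /\ induces_symmetric_scheme 6 (U6 R f).
Proof.
move=> r_eq.
pose cls x : nat := if x == 0 then 0 else
  if x \notin W then (if f x == 0 then 1 else if f x \in SQ p then 2 else 3)
  else if f x == 0 then 4 else if f x \in SQ p then 5 else 6.
(* [cls] does not test the orthogonal of [U]; for this [r] the test is determined by the others. *)
have zero_in_orth x : (x \in W) && (f x == 0) ==> (x \in orth U).
  by apply/implyP => /andP[xW /eqP]; apply: zero_orth.
(* Each test is recovered from the class number, so equal numbers give similar vectors. *)
have tab x : [/\ (x == 0) = (cls x == 0%N),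
    (x \in W) = (cls x \in [:: 0; 4; 5; 6]%N),
    (x \in orth U) = (cls x \in [:: 0; 4]%N),
    (f x == 0) = (cls x \in [:: 0; 1; 4]%N)
    & (f x \in SQ p) = (cls x \in [:: 2; 5]%N)].
  by rewrite /cls; have := zero_in_orth x; case_levels x.
apply: (@scheme_of_classes _ _ n_even 2 f g U W 6 (U6 R f) cls) => //.
- move=> x [i i_lt]; rewrite (tnth_nth set0) /U6 /=.
  by case: i i_lt => [|[|[|[|[|[|[|i]]]]]]] //= _; rewrite /cls; mem_levels x.
- by move=> x; rewrite /cls; repeat case: ifP => // _.
- have [ns] := exists_NSQ; rewrite mem_NSQ => /andP[/negPf ns0 /negPf ns_SQ].
  case=> i; case: i => [|[|[|[|[|[|[|i]]]]]]] //= _; rewrite /cls.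
  + by exists 0; rewrite eqxx.
  + by have [x [/negPf xW fx]] := exists_out 0; class_of x xW fx (oner_eq0 F) SQ1.
  + by have [x [/negPf xW fx]] := exists_out 1; class_of x xW fx (oner_eq0 F) SQ1.
  + by have [x [/negPf xW fx]] := exists_out ns; class_of x xW fx ns0 ns_SQ.
  + have [x [xU x0]] := exists_orth; have [xW fx] := orth_in_level xU.
    by exists x; rewrite xW fx ?xU (negPf x0) ?eqxx.
  + by have [x [xW fx]] := exists_in (oner_neq0 _); class_of x xW fx (oner_eq0 F) SQ1.
  + by have [x [xW fx]] := exists_in (negbT ns0); class_of x xW fx ns0 ns_SQ.
- by move=> x; have [<-] := tab x.
- move=> x y xy; have [x1 x2 x3 x4 x5] := tab x; have [y1 y2 y3 y4 y5] := tab y.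
  by apply: similar2P; rewrite ?x1 ?x2 ?x3 ?x4 ?x5 ?y1 ?y2 ?y3 ?y4 ?y5 xy.
- by move=> x y /similar2E[h1 h2 h3 h4 h5]; rewrite /cls h1 h2 ?h3 h4 h5.
Qed.

Lemma U7_scheme : r = m.+1 ->
  tuple_partition (U7 R f) /\ induces_symmetric_scheme 4 (U7 R f).
Proof.
move=> r_eq.
pose cls x : nat := if x == 0 then 0 else
  if x \notin W then (if f x == 0 then 1 else 2)
  else if f x == 0 then 3 else 4.
have zero_in_orth x : (x \in W) && (f x == 0) ==> (x \in orth U).
  by apply/implyP => /andP[xW /eqP]; apply: zero_orth.
have tab x : [/\ (x == 0) = (cls x == 0%N),
    (x \in W) = (cls x \in [:: 0; 3; 4]%N),
    (x \in orth U) = (cls x \in [:: 0; 3]%N)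
    & (f x == 0) = (cls x \in [:: 0; 1; 3]%N)].
  by rewrite /cls; have := zero_in_orth x; case_levels x.
apply: (@scheme_of_classes _ _ n_even 1 f g U W 4 (U7 R f) cls) => //.
- move=> x [i i_lt]; rewrite (tnth_nth set0) /U7 /=.
  by case: i i_lt => [|[|[|[|[|i]]]]] //= _; rewrite /cls; mem_levels x.
- by move=> x; rewrite /cls; repeat case: ifP => // _.
- have [ns] := exists_NSQ; rewrite mem_NSQ => /andP[/negPf ns0 /negPf ns_SQ].
  case=> i; case: i => [|[|[|[|[|i]]]]] //= _; rewrite /cls.
  + by exists 0; rewrite eqxx.
  + by have [x [/negPf xW fx]] := exists_out 0; class_of x xW fx (oner_eq0 F) SQ1.
  + by have [x [/negPf xW fx]] := exists_out 1; class_of x xW fx (oner_eq0 F) SQ1.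
  + have [x [xU x0]] := exists_orth; have [xW fx] := orth_in_level xU.
    by exists x; rewrite xW fx ?xU (negPf x0) ?eqxx.
  + by have [x [xW fx]] := exists_in (oner_neq0 _); class_of x xW fx (oner_eq0 F) SQ1.
- by move=> x; have [<-] := tab x.
- move=> x y xy; have [x1 x2 x3 x4] := tab x; have [y1 y2 y3 y4] := tab y.
  by apply: similar1P; rewrite ?x1 ?x2 ?x3 ?x4 ?y1 ?y2 ?y3 ?y4 xy.
- by move=> x y /similar1E[h1 h2 h3 h4]; rewrite /cls h1 h2 ?h3 h4.
Qed.

Lemma U8_scheme : (m.+1 < r)%N ->
  tuple_partition (U8 R f) /\ induces_symmetric_scheme 7 (U8 R f).
Proof.
move=> r_eq.
pose cls x : nat := if x == 0 then 0 else
  if x \notin W then (if f x == 0 then 1 else if f x \in SQ p then 2 else 3)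
  else if x \in orth U then 4
  else if f x == 0 then 5 else if f x \in SQ p then 6 else 7.
have tab x : [/\ (x == 0) = (cls x == 0%N),
    (x \in W) = (cls x \in [:: 0; 4; 5; 6; 7]%N),
    (x \in orth U) = (cls x \in [:: 0; 4]%N),
    (f x == 0) = (cls x \in [:: 0; 1; 4; 5]%N)
    & (f x \in SQ p) = (cls x \in [:: 2; 6]%N)].
  by rewrite /cls; case_levels x.
apply: (@scheme_of_classes _ _ n_even 2 f g U W 7 (U8 R f) cls) => //.
- move=> x [i i_lt]; rewrite (tnth_nth set0) /U8 /= fU.
  by case: i i_lt => [|[|[|[|[|[|[|[|i]]]]]]]] //= _; rewrite /cls; mem_levels x.
- by move=> x; rewrite /cls; repeat case: ifP => // _.
- have [ns] := exists_NSQ; rewrite mem_NSQ => /andP[/negPf ns0 /negPf ns_SQ].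
  case=> i; case: i => [|[|[|[|[|[|[|[|i]]]]]]]] //= _; rewrite /cls.
  + by exists 0; rewrite eqxx.
  + by have [x [/negPf xW fx]] := exists_out 0; class_of x xW fx (oner_eq0 F) SQ1.
  + by have [x [/negPf xW fx]] := exists_out 1; class_of x xW fx (oner_eq0 F) SQ1.
  + by have [x [/negPf xW fx]] := exists_out ns; class_of x xW fx ns0 ns_SQ.
  + have [x [xU x0]] := exists_orth; have [xW fx] := orth_in_level xU.
    by exists x; rewrite xW fx ?xU (negPf x0) ?eqxx.
  + have [x [xW fx /negPf xU]] := exists_zero_not_orth r_eq; exists x.
    by move: (level_implications x); rewrite xW fx xU eqxx; case: (x == 0).
  + by have [x [xW fx]] := exists_in (oner_neq0 _); class_of x xW fx (oner_eq0 F) SQ1.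
  + by have [x [xW fx]] := exists_in (negbT ns0); class_of x xW fx ns0 ns_SQ.
- by move=> x; have [<-] := tab x.
- move=> x y xy; have [x1 x2 x3 x4 x5] := tab x; have [y1 y2 y3 y4 y5] := tab y.
  by apply: similar2P; rewrite ?x1 ?x2 ?x3 ?x4 ?x5 ?y1 ?y2 ?y3 ?y4 ?y5 xy.
- by move=> x y /similar2E[h1 h2 h3 h4 h5]; rewrite /cls h1 h2 ?h3 h4 h5.
Qed.

Lemma U9_scheme : (m.+1 < r)%N ->
  tuple_partition (U9 R f) /\ induces_symmetric_scheme 5 (U9 R f).
Proof.
move=> r_eq.
pose cls x : nat := if x == 0 then 0 else
  if x \notin W then (if f x == 0 then 1 else 2)
  else if x \in orth U then 3
  else if f x == 0 then 4 else 5.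
have tab x : [/\ (x == 0) = (cls x == 0%N),
    (x \in W) = (cls x \in [:: 0; 3; 4; 5]%N),
    (x \in orth U) = (cls x \in [:: 0; 3]%N)
    & (f x == 0) = (cls x \in [:: 0; 1; 3; 4]%N)].
  by rewrite /cls; case_levels x.
apply: (@scheme_of_classes _ _ n_even 1 f g U W 5 (U9 R f) cls) => //.
- move=> x [i i_lt]; rewrite (tnth_nth set0) /U9 /= fU.
  by case: i i_lt => [|[|[|[|[|[|i]]]]]] //= _; rewrite /cls; mem_levels x.
- by move=> x; rewrite /cls; repeat case: ifP => // _.
- have [ns] := exists_NSQ; rewrite mem_NSQ => /andP[/negPf ns0 /negPf ns_SQ].
  case=> i; case: i => [|[|[|[|[|[|i]]]]]] //= _; rewrite /cls.
  + by exists 0; rewrite eqxx.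
  + by have [x [/negPf xW fx]] := exists_out 0; class_of x xW fx (oner_eq0 F) SQ1.
  + by have [x [/negPf xW fx]] := exists_out 1; class_of x xW fx (oner_eq0 F) SQ1.
  + have [x [xU x0]] := exists_orth; have [xW fx] := orth_in_level xU.
    by exists x; rewrite xW fx ?xU (negPf x0) ?eqxx.
  + have [x [xW fx /negPf xU]] := exists_zero_not_orth r_eq; exists x.
    by move: (level_implications x); rewrite xW fx xU eqxx; case: (x == 0).
  + by have [x [xW fx]] := exists_in (oner_neq0 _); class_of x xW fx (oner_eq0 F) SQ1.
- by move=> x; have [<-] := tab x.
- move=> x y xy; have [x1 x2 x3 x4] := tab x; have [y1 y2 y3 y4] := tab y.
  by apply: similar1P; rewrite ?x1 ?x2 ?x3 ?x4 ?y1 ?y2 ?y3 ?y4 xy.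
- by move=> x y /similar1E[h1 h2 h3 h4]; rewrite /cls h1 h2 ?h3 h4.
Qed.

End Families.
End Characters.

Local Close Scope ring_scope.

Theorem proposition2 (R : realType) (p n r : nat) (f : 'rV['F_p]_n -> 'F_p)
  (p_prime : prime p) (p_odd : odd p)
  (n_ge4 : 4 <= n) (n_even : ~~ odd n)
  (f_bent : bent R f) (f_nwr : ~ weakly_regular R f) (f_DBF : DBF R f)
  (Bf_dim : is_subspace_of_dim (Bminus R f) r)
  (Bf_nondeg : nondegenerate_space (Bminus R f))
  (Bfs_dim : is_subspace_of_dim (Bminus R (dual R f)) r)
  (Bfs_nondeg : nondegenerate_space (Bminus R (dual R f))) :
  (r = n./2 + 1 ->
     (tuple_partition (U6 R f) /\ induces_symmetric_scheme 6 (U6 R f)) /\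
     (tuple_partition (U7 R f) /\ induces_symmetric_scheme 4 (U7 R f))) /\
  (n./2 + 1 < r <= n - 1 ->
     (tuple_partition (U8 R f) /\ induces_symmetric_scheme 7 (U8 R f)) /\
     (tuple_partition (U9 R f) /\ induces_symmetric_scheme 5 (U9 R f))).
Proof.
have [U fU dimU] := Bf_dim; have [W gW dimW] := Bfs_dim.
have [[_ g_bent] _ _] := f_DBF.
have n2 : n = (n./2 * 2)%N by rewrite -[LHS]odd_double_half (negPf n_even) muln2.
have fg := DBF_dual_pair p_prime p_odd n2 f_bent g_bent f_DBF fU gW.

split.
  (* Here [n >= 4] enters: it makes [n/2 + 1 < n], so that [W] is proper and the orthogonal of [U]
     is nonzero. *)
  rewrite addn1 => r_eq; have r_lt : (r < n)%N by rewrite r_eq; lia.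
  split.
    exact: (U6_scheme p_prime p_odd n2 r_lt fg dimU dimW g_bent gW).
  exact: (U7_scheme p_prime p_odd n2 r_lt fg dimU dimW g_bent gW).
rewrite addn1 => /andP[r_gt r_le]; have r_lt : (r < n)%N by lia.
split.
  exact: (U8_scheme p_prime p_odd n2 r_lt fg dimU dimW g_bent fU gW).
exact: (U9_scheme p_prime p_odd n2 r_lt fg dimU dimW g_bent fU gW).
Qed.
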